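(* Let $d\ge 1$ and let $X=(X_n)_{n\in\mathbb{Z}_+}$ be a discrete-time, time-homogeneous Markov process on a non-empty, unbounded Borel set $\mathbb{X}\subseteq\mathbb{R}^d$, started from a fixed (non-random) point $X_0\in\mathbb{X}$, with one-step increment $\Delta=X_1-X_0$. Suppose that the following five conditions hold. (1) There exists $p>2$ such that $\sup_{\mathbf{x}\in\mathbb{X}}\mathbb{E}_{\mathbf{x}}[\|\Delta\|^p]<\infty$. (2) $\mathbb{E}_{\mathbf{x}}[\Delta]=\mathbf{0}$ for all $\mathbf{x}\in\mathbb{X}$. (3) There exists $v>0$ such that $\mathbb{E}_{\mathbf{x}}[\|\Delta\|^2]\ge v$ for all $\mathbf{x}\in\mathbb{X}$. (4) There exists a function $\sigma^2$ from $\mathbb{S}^{d-1}$ to the positive-definite (symmetric) $d\times d$ real matrices such that $$\varepsilon(r):=\sup_{\mathbf{x}\in\mathbb{X}:\|\mathbf{x}\|\ge r}\|M(\mathbf{x})-\sigma^2(\hat{\mathbf{x}})\|_{\mathrm{op}}\to 0\quad\text{as } r\to\infty,$$ where $M(\mathbf{x}):=\mathbb{E}_{\mathbf{x}}[\Delta\Delta^{\top}]$. (5) There exist constants $U,V$ with $0<U<V<\infty$ such that, for all $\mathbf{u}\in\mathbb{S}^{d-1}$, $\mathbf{u}^{\top}\sigma^2(\mathbf{u})\mathbf{u}=U$ and $\operatorname{tr}(\sigma^2(\mathbf{u}))=V$. Then: (i) if $2U<V$, then $X$ is transient; (ii) if $2U>V$, then $X$ is recurrent; (iii) if $2U=V$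 and $\varepsilon(r)=O(r^{-\delta_0})$ as $r\to\infty$ for some $\delta_0>0$, then $X$ is recurrent.
   Context: $\mathbb{Z}_+=\{0,1,2,\ldots\}$ and $\mathbb{R}_+=[0,\infty)$. $\|\cdot\|$ is the Euclidean norm on $\mathbb{R}^d$, $\mathbb{S}^{d-1}=\{\mathbf{u}\in\mathbb{R}^d:\|\mathbf{u}\|=1\}$, and $\|M\|_{\mathrm{op}}=\sup_{\mathbf{u}\in\mathbb{S}^{d-1}}\|M\mathbf{u}\|$. For $\mathbf{x}\ne\mathbf{0}$, $\hat{\mathbf{x}}=\mathbf{x}/\|\mathbf{x}\|$, and $\hat{\mathbf{0}}=\mathbf{e}_1$ (first standard basis vector). Vectors are column vectors. $\mathbb{P}_{\mathbf{x}}$ and $\mathbb{E}_{\mathbf{x}}$ denote probability and expectation for the process started from $X_0=\mathbf{x}\in\mathbb{X}$. By the time-homogeneous Markov property, given $X_0,\ldots,X_n$, the law of $X_{n+1}-X_n$ depends only on $X_n$ and, given $X_n=\mathbf{x}$, equals the law of $\Delta$ under $\mathbb{P}_{\mathbf{x}}$. $X$ is called transient if $\lim_{n\to\infty}\|X_n\|=+\infty$ almost surely. $X$ is called recurrent if there is a constant $r_0\in\mathbb{R}_+$ such that $\liminf_{n\to\infty}\|X_n\|\le r_0$ almost surely. *)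

(* Defs.v *)
From HB Require Import structures.
From mathcomp Require Import all_boot all_order all_algebra.
From mathcomp Require Import all_classical all_reals all_analysis.

Set Implicit Arguments.
Unset Strict Implicit.
Unset Printing Implicit Defensive.

Import Order.TTheory GRing.Theory Num.Theory.
Import numFieldNormedType.Exports.

Local Open Scope classical_set_scope.
Local Open Scope ring_scope.

(* R^d with its Borel sigma-algebra; convertible to 'cV[R]_d. *)
Notation borel_cV R d := (g_sigma_algebraType (@open 'cV[R]_d)).

Section euclidean.
Context {R : realType} {d : nat}.
Implicit Types (x u : 'cV[R]_d) (A : 'M[R]_d).

(* The library's norm on matrices is the max norm, hence this definition. *)
Definition enorm x : R := Num.sqrt (\sum_(i < d) x i 0 ^+ 2).

Definition sphere : set 'cV[R]_d := [set u | enorm u = 1].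

Definition opnorm A : R := sup [set enorm (A *m u) | u in sphere].

Definition e1 : 'cV[R]_d := \col_(i < d) (i == 0 :> nat)%:R.

Definition hat x : 'cV[R]_d := if x == 0 then e1 else (enorm x)^-1 *: x.

Definition posdef A : Prop :=
  A^T = A /\ forall x, x != 0 -> 0 < (x^T *m A *m x) 0 0.

Definition unbounded (S : set 'cV[R]_d) : Prop :=
  forall r : R, exists2 x, S x & r < enorm x.

End euclidean.

Section increments.
Context {R : realType} {d : nat}.
Variable K : R.-pker (borel_cV R d) ~> (borel_cV R d).
Implicit Types x : 'cV[R]_d.

(* K x is the law of X_1 under P_x, so this is E_x[f(Delta)]. *)
Definition E_incr x (f : 'cV[R]_d -> R) : \bar R :=
  (\int[K x]_y (f ((y : 'cV[R]_d) - x))%:E)%E.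

(* In the next two definitions [fine] sends infinite values to 0; it is
   harmless when the increments have a finite second moment under K x. *)
Definition drift x : 'cV[R]_d :=
  \col_(i < d) fine (E_incr x (fun D => D i 0)).

Definition incr_cov x : 'M[R]_d :=
  \matrix_(i < d, j < d) fine (E_incr x (fun D => (D *m D^T) i j)).

(* Extended-real valued, as no finiteness is built into the supremum. *)
Definition cov_error (S : set 'cV[R]_d) (sigma2 : 'cV[R]_d -> 'M[R]_d)
    (r : R) : \bar R :=
  ereal_sup [set (opnorm (incr_cov x - sigma2 (hat x)))%:E
            | x in [set x | S x /\ r <= enorm x]].

End increments.

Section process.
Context {R : realType} {d : nat} {disp : measure_display}.
Context {Omega : measurableType disp}.
Variable P : probability Omega R.
Implicit Type X : nat -> Omega -> borel_cV R d.

(* The sigma-algebra generated by X_0, ..., X_n. *)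
Definition history X (n : nat) : set (set Omega) :=
  <<s \bigcup_(k in [set k | (k <= n)%N])
        preimage_set_system setT (X k) measurable >>.

(* A kernel on the Borel set S is represented by a kernel on the whole space
   whose values outside S are irrelevant. The last field says that
   P(X_{n+1} \in B | X_0, ..., X_n) = K(X_n, B) almost surely. *)
Record markov_process (S : set 'cV[R]_d)
    (K : R.-pker (borel_cV R d) ~> (borel_cV R d)) (x0 : 'cV[R]_d) X : Prop :=
  MarkovProcess {
    mp_kernel : forall x, S x -> K x S = 1%E ;
    mp_measurable : forall n, measurable_fun setT (X n) ;
    mp_state : forall n w, S (X n w) ;
    mp_start : forall w, X 0%N w = x0 ;
    mp_markov : forall n A (B : set (borel_cV R d)),
      history X n A -> measurable B ->
      P (A `&` X n.+1 @^-1` B) = (\int[P]_(w in A) K (X n w) B)%E }.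

Definition transient X : Prop :=
  {ae P, forall w, enorm (X n w) @[n --> \oo] --> +oo}.

Definition recurrent X : Prop :=
  exists2 r0 : R, 0 <= r0 &
    {ae P, forall w, (limn_einf (fun n => (enorm (X n w))%:E) <= r0%:E)%E}.

End process.

(* Main.v *)
(**
Write s = 1 + |x|^2. A second-order expansion with a remainder of order p
gives, with T = tr M(x) ~ V and Q = x^T M(x) x / s ~ U,
  E_x[ln s(X_1)] - ln s <= (T - 2 Q) / s + O(s^(-p/2)),
  E_x[s(X_1)^(-a)] - s^(-a) = a s^(-1-a) (2 (a + 1) Q - T) + O(s^(-p/2)).
If 2U < V, then s^(-a) is a supermartingale far from the origin for small
a > 0; it vanishes at infinity, so that from far away a return to a ball is
unlikely. If 2U >= V, then ln s + 1 - s^(-a) is a supermartingale far from the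
origin that tends to infinity, so that the walk reaches a fixed ball before a
distant sphere with high probability. In both cases the walk leaves every
ball, since the truncation of |x|^2 at a high level has drift at least v / 2
there.
*)

Require Import Defs.
From HB Require Import structures.
From mathcomp Require Import all_boot all_order all_algebra.
From mathcomp Require Import all_classical all_reals all_analysis.
From mathcomp Require Import measurable_realfun ring lra.

Set Implicit Arguments.
Unset Strict Implicit.
Unset Printing Implicit Defensive.

Import Order.TTheory GRing.Theory Num.Theory.
Import numFieldNormedType.Exports.

Local Open Scope classical_set_scope.
Local Open Scope ring_scope.

(** Lyapunov inequalities are only ever summed up to a finite horizon, over the events that the walk
    is still in [D] and that it has just stepped from [D] into [E]; countable additivity does the
    rest, so neither stopping times nor martingale convergence enter. Such sums bound the
    probability of leaving through the wrong side but do not show that the walk leaves at all. As no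
    irreducibility is assumed, this must come from the lower bound on the second moment, and it is a
    separate input to both criteria.

    The second obstacle is that only a moment of order p > 2 is available, so a cubic Taylor
    remainder cannot be integrated over all increments. Taylor's formula is used for increments that
    are small relative to sqrt s, crude global bounds for the others; once p is lowered to at most
    3, both errors are multiples of |D|^p s^(-p/2). Since p / 2 > 1, this is negligible against the
    main terms of order 1 / s.

    The summand 1 in ln s + 1 - s^(-a) keeps the function nonnegative. *)

(** * Second-order Taylor bound on an interval *)

Section taylor.
Context {R : realType}.
Implicit Types (f g : R -> R) (c r z a p q : R).

Lemma derive_bound_lipschitz f g c r (C : R) :
  (forall x, `|x - c| <= r -> is_derive x 1 f (g x)) ->
  (forall x, `|x - c| <= r -> `|g x| <= C) ->
  forall x, `|x - c| <= r -> `|f x - f c| <= C * `|x - c|.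
Proof.
move=> df gC x xc.
have [cx|xc'] := leP c x.
- have seg t : t \in `[c, x] -> `|t - c| <= r.
    rewrite in_itv /= => /andP[ct tx].
    rewrite ger0_norm ?subr_ge0//; apply: le_trans xc.
    by rewrite ger0_norm ?subr_ge0// lerB.
  have [||t tcx ->] := @MVT_segment R f g c x cx.
  + by move=> t tcx; apply/df/seg/subset_itv_oo_cc.
  + apply: derivable_within_continuous => t tcx.
    by case: (df t (seg _ tcx)).
  + by rewrite normrM ler_wpM2r// gC// seg.
- have seg t : t \in `[x, c] -> `|t - c| <= r.
    rewrite in_itv /= => /andP[xt tc].
    rewrite ler0_norm ?subr_le0//; apply: le_trans xc.
    by rewrite ler0_norm ?subr_le0 ?(ltW xc')// lerN2 lerB.
  have [||t tcx] := @MVT_segment R f g x c (ltW xc').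
  + by move=> t tcx; apply/df/seg/subset_itv_oo_cc.
  + apply: derivable_within_continuous => t tcx.
    by case: (df t (seg _ tcx)).
  + rewrite -normrN opprB => ->.
    by rewrite normrM [`|c - x|]distrC ler_wpM2r// gC// seg.
Qed.

(** The mean value inequality is applied three times, to [f2], to [f1] minus its linear part and to
    [f] minus its quadratic part. Each time the derivative is bounded by its maximum over |t - c| <=
    |x - c|, which is why the constant is C and not C / 6. *)
Lemma taylor2 f f1 f2 f3 c r (C : R) :
  (forall x, `|x - c| <= r -> is_derive x 1 f (f1 x)) ->
  (forall x, `|x - c| <= r -> is_derive x 1 f1 (f2 x)) ->
  (forall x, `|x - c| <= r -> is_derive x 1 f2 (f3 x)) ->
  (forall x, `|x - c| <= r -> `|f3 x| <= C) ->
  forall x, `|x - c| <= r ->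
  `|f x - (f c + f1 c * (x - c) + f2 c / 2 * (x - c) ^+ 2)|
    <= C * `|x - c| ^+ 3.
Proof.
move=> d1 d2 d3 f3C x xr; set s : R := `|x - c|.
have C0 : 0 <= C by apply: le_trans (f3C x xr).
have sub t : `|t - c| <= s -> `|t - c| <= r by move=> /le_trans; apply.
have b2 t : `|t - c| <= s -> `|f2 t - f2 c| <= C * s.
  move=> ts; apply: (le_trans (derive_bound_lipschitz d3 f3C (sub _ ts))).
  exact: ler_wpM2l.
have e1 t : `|t - c| <= s ->
    is_derive t 1 (fun t => f1 t - f2 c * (t - c)) (f2 t - f2 c).
  move=> ts; have := d2 t (sub _ ts) => ?.
  by apply: is_derive_eq; rewrite /GRing.scale/= subr0 mulr1.
have b1 t : `|t - c| <= s ->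
    `|f1 t - f2 c * (t - c) - f1 c| <= C * s * s.
  move=> ts; have := derive_bound_lipschitz e1 b2 ts.
  rewrite subrr mulr0 subr0 => /le_trans; apply.
  by rewrite ler_wpM2l// mulr_ge0// normr_ge0.
have e0 t : `|t - c| <= s ->
    is_derive t 1
      (fun t => f t - f1 c * (t - c) - f2 c / 2 * ((t - c) * (t - c)))
      (f1 t - f2 c * (t - c) - f1 c).
  move=> ts; have ? := d1 t (sub _ ts).
  apply: is_derive_eq; rewrite /GRing.scale/= !subr0 !mulr1.
  by field.
have := derive_bound_lipschitz e0 b1 (lexx s).
rewrite subrr !mulr0 !subr0 -/s.
have -> : C * s ^+ 3 = C * s * s * s by ring.
by congr (`|_| <= _); ring.
Qed.

End taylor.

(** * Expansions of the logarithm and of negative powers *)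

Section expansions.
Context {R : realType}.
Implicit Types (a p q t w r z : R).

Let near1_gt0 t : `|t - 1| <= 3 / 4 -> 0 < t.
Proof. by rewrite ler_norml => /andP[? _]; lra. Qed.

(** On [1/4, 7/4] the absolute value of ln t is at most ln 4, which settles both signs of [a]. The
    radius 3/4 is what an increment with r <= 1/4 can produce: |2 w + r^2| <= 3 r <= 3/4. *)
Lemma powR_near1_le a t : `|t - 1| <= 3 / 4 -> t `^ a <= expR (`|a| * ln 4).
Proof.
move=> t1; have t0 := near1_gt0 t1.
rewrite /powR gt_eqF// ler_expR (le_trans (ler_norm _))// normrM ler_wpM2l//.
have pos4 : (4 : R) \is Num.pos by rewrite posrE.
rewrite ler_norml -lnV// !ler_ln ?posrE ?invr_gt0//.
by move: t1; rewrite ler_norml => /andP[? ?]; apply/andP; split; lra.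
Qed.

(** The successive derivatives are written as powers of t, so that [powR_near1_le] with exponent -3
    bounds the third one. *)
Lemma ln_taylor2 : exists2 C : R, 0 <= C & forall t, `|t - 1| <= 3 / 4 ->
  `|ln t - ((t - 1) - (t - 1) ^+ 2 / 2)| <= C * `|t - 1| ^+ 3.
Proof.
exists (2 * expR (`|-3| * ln 4)); first by rewrite mulr_ge0// expR_ge0.
move=> t t1.
have E1 : (-1 - 1 : R) = -2 by ring.
have E2 : (-2 - 1 : R) = -3 by ring.
have := @taylor2 R (@ln R) (@powR R ^~ (-1)) (fun x => -1 * x `^ (-2))
  (fun x => -1 * (-2 * x `^ (-3))) 1 (3 / 4) (2 * expR (`|-3| * ln 4)).
move=> /(_ _ _ _ _ t t1) H.
have {H} : `|ln t - (ln 1 + 1 `^ (-1) * (t - 1) + -1 * 1 `^ (-2) / 2 *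
    (t - 1) ^+ 2)| <= 2 * expR (`|-3| * ln 4) * `|t - 1| ^+ 3.
  apply: H => x x1; have x0 := near1_gt0 x1.
  - by rewrite powR_inv1 ?(ltW x0)//; exact: is_derive1_ln.
  - by rewrite -E1; exact: is_derive1_powR.
  - have := is_derive1_powR (-2) x0; rewrite E2 => ?.
    by apply: is_derive_eq.
  - rewrite mulN1r mulNr opprK normrM ger0_norm//.
    rewrite ger0_norm ?powR_ge0// ler_wpM2l//; exact: powR_near1_le.
by rewrite ln1 !powR1; congr (`|_| <= _); field.
Qed.

Lemma powR_taylor2 a : exists2 C : R, 0 <= C & forall t, `|t - 1| <= 3 / 4 ->
  `|t `^ a - (1 + a * (t - 1) + a * (a - 1) / 2 * (t - 1) ^+ 2)|
    <= C * `|t - 1| ^+ 3.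
Proof.
exists (`|a * ((a - 1) * (a - 1 - 1))| * expR (`|a - 1 - 1 - 1| * ln 4)).
  by rewrite mulr_ge0// expR_ge0.
move=> t t1.
have := @taylor2 R (@powR R ^~ a) (fun x => a * x `^ (a - 1))
  (fun x => a * ((a - 1) * x `^ (a - 1 - 1)))
  (fun x => a * ((a - 1) * ((a - 1 - 1) * x `^ (a - 1 - 1 - 1)))) 1 (3 / 4)
  (`|a * ((a - 1) * (a - 1 - 1))| * expR (`|a - 1 - 1 - 1| * ln 4)).
move=> /(_ _ _ _ _ t t1) H.
have {H} : `|t `^ a - (1 `^ a + a * 1 `^ (a - 1) * (t - 1) +
    a * ((a - 1) * 1 `^ (a - 1 - 1)) / 2 * (t - 1) ^+ 2)| <=
    `|a * ((a - 1) * (a - 1 - 1))| * expR (`|a - 1 - 1 - 1| * ln 4) *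
    `|t - 1| ^+ 3.
  apply: H => x x1; have x0 := near1_gt0 x1.
  - exact: is_derive1_powR.
  - have := is_derive1_powR (a - 1) x0 => ?.
    by apply: is_derive_eq.
  - have := is_derive1_powR (a - 1 - 1) x0 => ?.
    by apply: is_derive_eq.
  - rewrite !mulrA normrM [X in _ * X]ger0_norm ?powR_ge0//.
    by rewrite ler_wpM2l//; exact: powR_near1_le.
by rewrite !powR1 !mulr1.
Qed.

(* With [s = 1 + |x|^2], the increment [D] enters through [w = x.D / s] and
   [r = |D| / sqrt s], since [1 + |x + D|^2 = s (1 + 2 w + r^2)]. For small [r]
   the remainders are cubic, hence at most [r^p] as [p <= 3]; for large [r] the
   terms of order at most two are themselves at most a multiple of [r^p]. *)
Section increment.
Variable p : R.
Hypothesis p23 : 2 < p <= 3.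

Let p0 : p != 0. Proof. by case/andP: p23 => ? ?; apply/eqP; lra. Qed.

Lemma cube_le_powR r : 0 <= r <= 1 -> r ^+ 3 <= r `^ p.
Proof.
case/andP=> r0 r1; have [->|rn0] := eqVneq r 0.
  by rewrite expr0n /= powR0.
rewrite -powR_mulrn// ger_powR ?lt_neqAle 1?eq_sym ?rn0 ?r0//.
by case/andP: p23.
Qed.

(** Multiplication by 4 brings r into the range where powers increase with the exponent: (4 r)^2 <=
    (4 r)^p, and 4^p <= 4^3. *)
Lemma sqr_le_powR r : 1 / 4 <= r -> r ^+ 2 <= 4 * r `^ p.
Proof.
move=> r4; have r0 : 0 <= r by lra.
have h : (4 * r) `^ 2 <= (4 * r) `^ p.
  by apply: ler_powR; [lra|case/andP: p23 => /ltW].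
have h4 : 4 `^ p <= 4 ^+ 3 :> R.
  by rewrite -powR_mulrn// ler_powR//; [lra|case/andP: p23].
rewrite -[2]/(2%:R) powR_mulrn ?mulr_ge0// powRM// in h.
have := ler_wpM2r (powR_ge0 r p) h4.
rewrite exprMn in h; lra.
Qed.

Let z_le w r : `|w| <= r -> r <= 1 / 4 -> `|2 * w + r ^+ 2| <= 3 * r.
Proof.
rewrite !ler_norml => /andP[? ?] ?.
by apply/andP; split; nra.
Qed.

Let z_near w r : `|w| <= r -> r <= 1 / 4 -> `|2 * w + r ^+ 2| <= 3 / 4.
Proof. by move=> wr r4; apply: le_trans (z_le wr r4) _; lra. Qed.

Let z3_le w r : `|w| <= r -> r <= 1 / 4 ->
  `|2 * w + r ^+ 2| ^+ 3 <= 27 * r `^ p.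
Proof.
move=> wr r4; have r0 : 0 <= r by exact: le_trans wr.
have r1 : 0 <= r <= 1 by rewrite r0/=; lra.
apply: (@le_trans _ _ (27 * r ^+ 3)); last by rewrite ler_wpM2l// cube_le_powR.
have -> : 27 * r ^+ 3 = (3 * r) ^+ 3 by ring.
by rewrite lerXn2r ?nnegrE ?mulr_ge0// z_le.
Qed.

Let z2_le w r : `|w| <= r -> r <= 1 / 4 ->
  `|(2 * w + r ^+ 2) ^+ 2 - 4 * w ^+ 2| <= 5 * r `^ p.
Proof.
move=> wr r4; have r0 : 0 <= r by exact: le_trans wr.
have r1 : 0 <= r <= 1 by rewrite r0/=; lra.
apply: (@le_trans _ _ (5 * r ^+ 3)); last by rewrite ler_wpM2l// cube_le_powR.
have -> : (2 * w + r ^+ 2) ^+ 2 - 4 * w ^+ 2 = r ^+ 2 * (4 * w + r ^+ 2).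
  by ring.
have -> : 5 * r ^+ 3 = r ^+ 2 * (5 * r) by ring.
rewrite normrM ger0_norm ?sqr_ge0// ler_wpM2l ?sqr_ge0//.
move: wr; rewrite !ler_norml => /andP[? ?].
by apply/andP; split; nra.
Qed.

(** For large r, concavity gives ln (1 + z) <= z, and the subtracted 2 w^2 is at most 2 r^2 <= 8
    r^p; this is the 8 in the constant. *)
Lemma ln_increment_le : exists2 C : R, 0 <= C & forall w r, `|w| <= r ->
  0 < 1 + (2 * w + r ^+ 2) ->
  ln (1 + (2 * w + r ^+ 2)) <= 2 * w + r ^+ 2 - 2 * w ^+ 2 + C * r `^ p.
Proof.
have [C C0 HC] := ln_taylor2.
exists (27 * C + 8) => [|w r wr z0]; first lra.
have pr0 := powR_ge0 r p.
have [r4|/ltW r4] := leP r (1 / 4).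
- have := HC (1 + (2 * w + r ^+ 2)).
  rewrite [1 + _]addrC addrK => /(_ (z_near wr r4)) /(le_trans (ler_norm _)).
  have := ler_wpM2l C0 (z3_le wr r4).
  have := z2_le wr r4; rewrite ler_norml => /andP[+ _].
  rewrite mulrDl; set z3 := _ ^+ 3; set z := 2 * w + _; lra.
- have := @le_ln1Dx R (2 * w + r ^+ 2).
  have := sqr_le_powR r4.
  have w2 : w ^+ 2 <= r ^+ 2.
    by rewrite -real_normK ?num_real// lerXn2r ?nnegrE//; exact: le_trans wr.
  have := mulr_ge0 C0 pr0.
  move=> + + /(_ _); rewrite mulrDl; move=> ? ?; have -> : -1 < 2 * w + r ^+ 2.
    lra.
  move=> /(_ isT) ?; lra.
Qed.

(** For large r the tangent bound (1 + z)^(-a) >= 1 - a z replaces Taylor's formula, and the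
    quadratic term is absorbed by 8 a (a + 1) r^p. *)
Lemma powR_increment_ge a : 0 < a -> exists2 C : R, 0 <= C &
  forall w r, `|w| <= r -> 0 < 1 + (2 * w + r ^+ 2) ->
  1 - a * (2 * w + r ^+ 2) + 2 * a * (a + 1) * w ^+ 2 - C * r `^ p
    <= (1 + (2 * w + r ^+ 2)) `^ (- a).
Proof.
move=> a0; have [C C0 HC] := powR_taylor2 (- a).
exists (27 * C + 8 * a * (a + 1)) => [|w r wr z0].
  by rewrite addr_ge0 ?mulr_ge0//; lra.
have pr0 := powR_ge0 r p.
have aa0 : 0 <= a * (a + 1) by rewrite mulr_ge0//; lra.
have [r4|/ltW r4] := leP r (1 / 4).
- have := HC (1 + (2 * w + r ^+ 2)).
  rewrite [1 + (_ + _)]addrC addrK => /(_ (z_near wr r4)).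
  rewrite ler_norml => /andP[+ _].
  have := ler_wpM2l C0 (z3_le wr r4).
  have := z2_le wr r4; rewrite ler_norml => /andP[+ _].
  move=> /(ler_wpM2l aa0).
  set z3 := _ ^+ 3; set z := 2 * w + _; set y := _ `^ (- a).
  set x := r `^ p; set v := z ^+ 2; set u := w ^+ 2.
  move=> h1 h2 h3; have := mulr_ge0 aa0 pr0; rewrite -/x => h4.
  have -> : 2 * a * (a + 1) * u = 2 * (a * (a + 1) * u) by ring.
  have E : - a * (- a - 1) / 2 * v = a * (a + 1) * v / 2 by field.
  rewrite E in h3.
  have -> : (27 * C + 8 * a * (a + 1)) * x =
    27 * (C * x) + 8 * (a * (a + 1) * x) by ring.
  have E2 : a * (a + 1) * (v - 4 * u) = a * (a + 1) * v - 4 * (a * (a + 1) * u).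
    by ring.
  have E3 : a * (a + 1) * (5 * x) = 5 * (a * (a + 1) * x) by ring.
  rewrite mulrN E2 E3 in h1.
  lra.
- have z1 : -1 < 2 * w + r ^+ 2 by lra.
  have := sqr_le_powR r4.
  have w2 : w ^+ 2 <= r ^+ 2.
    by rewrite -real_normK ?num_real// lerXn2r ?nnegrE//; exact: le_trans wr.
  move=> /(le_trans w2) /(ler_wpM2l aa0).
  have : 1 - a * (2 * w + r ^+ 2) <= (1 + (2 * w + r ^+ 2)) `^ (- a).
    rewrite /powR gt_eqF// (le_trans _ (expR_ge1Dx _))// lerD2l mulNr lerN2.
    by rewrite ler_wpM2l ?(ltW a0)// le_ln1Dx.
  have := mulr_ge0 C0 pr0.
  set y := _ `^ (- a); set x := r `^ p; set u := w ^+ 2.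
  have -> : 2 * a * (a + 1) * u = 2 * (a * (a + 1) * u) by ring.
  have -> : (27 * C + 8 * a * (a + 1)) * x =
    27 * (C * x) + 8 * (a * (a + 1) * x) by ring.
  have -> : a * (a + 1) * (4 * x) = 4 * (a * (a + 1) * x) by ring.
  lra.
Qed.

(* The factor [k] (to be [s^-a]) is kept inside: for large [r] the left-hand
   side is only controlled through its bound [1]. *)
Lemma powR_increment_le a : 0 < a -> exists2 C : R, 0 <= C &
  forall k w r, 0 <= k <= 1 -> `|w| <= r -> 0 < 1 + (2 * w + r ^+ 2) ->
  k * (1 + (2 * w + r ^+ 2)) `^ (- a) <= 1 ->
  k * (1 + (2 * w + r ^+ 2)) `^ (- a) <=
  k * (1 - a * (2 * w + r ^+ 2) + 2 * a * (a + 1) * w ^+ 2) + C * r `^ p.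
Proof.
move=> a0; have [C C0 HC] := powR_taylor2 (- a).
have aa0 : 0 <= a * (a + 1) by rewrite mulr_ge0//; lra.
exists (27 * C + 3 * (a * (a + 1)) + 36 * a + 64); first lra.
move=> k w r /andP[k0 k1] wr z0 kz.
have pr0 := powR_ge0 r p.
have apr0 := mulr_ge0 (ltW a0) pr0.
have aapr0 := mulr_ge0 aa0 pr0.
have cpr0 := mulr_ge0 C0 pr0.
have [r4|/ltW r4] := leP r (1 / 4).
- have := HC (1 + (2 * w + r ^+ 2)).
  rewrite [1 + (_ + _)]addrC addrK => /(_ (z_near wr r4)).
  rewrite ler_norml => /andP[_].
  have := ler_wpM2l C0 (z3_le wr r4).
  have := z2_le wr r4; rewrite ler_norml => /andP[_].
  move=> /(ler_wpM2l aa0).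
  set z3 := _ ^+ 3; set z := 2 * w + _; set y := _ `^ (- a).
  set x := r `^ p; set v := z ^+ 2; set u := w ^+ 2.
  move=> h1 h2 h3.
  have E : - a * (- a - 1) / 2 * v = a * (a + 1) * v / 2 by field.
  rewrite E in h3.
  have E2 : a * (a + 1) * (v - 4 * u) = a * (a + 1) * v - 4 * (a * (a + 1) * u).
    by ring.
  have E3 : a * (a + 1) * (5 * x) = 5 * (a * (a + 1) * x) by ring.
  rewrite E2 E3 in h1.
  set D := (27 * C + 3 * (a * (a + 1)) + 36 * a + 64) * x.
  have D0 : 0 <= D by rewrite mulr_ge0//; lra.
  apply: (@le_trans _ _ (k * (1 - a * z + 2 * a * (a + 1) * u + D))).
    rewrite ler_wpM2l// /D.
    have -> : 2 * a * (a + 1) * u = 2 * (a * (a + 1) * u) by ring.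
    have -> : (27 * C + 3 * (a * (a + 1)) + 36 * a + 64) * x =
      27 * (C * x) + 3 * (a * (a + 1) * x) + 36 * (a * x) + 64 * x by ring.
    move: pr0 apr0 aapr0 cpr0; rewrite -/x => *; lra.
  by rewrite mulrDr lerD2l ler_piMl.
- have s2 := sqr_le_powR r4.
  have w2 : 0 <= w ^+ 2 by exact: sqr_ge0.
  apply: (le_trans kz).
  (* As r >= 1/4, 1/16 <= r^2 <= 4 r^p gives the 64; and 2 w + r^2 <= 2 r + r^2 <= 9 r^2 gives the
     36. *)
  have h1 : 1 <= 64 * r `^ p by nra.
  have h2 : 2 * w + r ^+ 2 <= 36 * r `^ p.
    have : w <= r by exact: le_trans (ler_norm _) wr.
    nra.
  have h3 : - (36 * a * r `^ p) <=
      k * (1 - a * (2 * w + r ^+ 2) + 2 * a * (a + 1) * w ^+ 2).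
    have h4 := ler_wpM2l (ltW a0) h2.
    have h5 := mulr_ge0 aa0 w2.
    apply: (@le_trans _ _ (k * (- (36 * a * r `^ p)))).
      rewrite mulrN lerN2 ler_piMl// mulr_ge0//; lra.
    rewrite ler_wpM2l//.
    have -> : 2 * a * (a + 1) * w ^+ 2 = 2 * (a * (a + 1) * w ^+ 2) by ring.
    lra.
  have -> : (27 * C + 3 * (a * (a + 1)) + 36 * a + 64) * r `^ p =
    27 * (C * r `^ p) + 3 * (a * (a + 1) * r `^ p) + 36 * a * r `^ p
    + 64 * r `^ p by ring.
  lra.
Qed.

End increment.
End expansions.

(** * Euclidean norm, quadratic forms and operator norm *)

Section euclidean_facts.
Context {R : realType} {d : nat}.
Implicit Types (x y u : 'cV[R]_d) (A : 'M[R]_d).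

Definition dotp x y : R := \sum_(i < d) x i 0 * y i 0.

Lemma enorm_ge0 x : 0 <= enorm x. Proof. exact: sqrtr_ge0. Qed.

Lemma sqr_enorm x : enorm x ^+ 2 = dotp x x.
Proof.
rewrite sqr_sqrtr; last by apply: sumr_ge0 => i _; exact: sqr_ge0.
by apply: eq_bigr => i _; rewrite expr2.
Qed.

Lemma dotp_ge0 x : 0 <= dotp x x.
Proof. by rewrite -sqr_enorm sqr_ge0. Qed.

Lemma sqr_enormD x y :
  enorm (x + y) ^+ 2 = enorm x ^+ 2 + 2 * dotp x y + enorm y ^+ 2.
Proof.
rewrite !sqr_enorm /dotp mulr_sumr -!big_split /=.
by apply: eq_bigr => i _; rewrite !mxE; ring.
Qed.

Lemma cauchy_schwarz x y : `|dotp x y| <= enorm x * enorm y.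
Proof.
rewrite -(@ler_pXn2r _ 2) ?nnegrE ?mulr_ge0 ?enorm_ge0//.
rewrite real_normK ?num_real// exprMn !sqr_enorm.
set B := dotp y y; set c := dotp x y.
(* The expression is |B x - c y|^2. Dividing by B gives the claim, hence the separate case y = 0. *)
have H : 0 <= B * (dotp x x * B - c ^+ 2).
  have -> : B * (dotp x x * B - c ^+ 2) =
      \sum_(i < d) (B * x i 0 - c * y i 0) ^+ 2.
    have -> b e : \sum_(i < d) (b * x i 0 - e * y i 0) ^+ 2 =
        b ^+ 2 * dotp x x - 2 * b * e * dotp x y + e ^+ 2 * dotp y y.
      rewrite /dotp !mulr_sumr -sumrB -big_split /=.
      by apply: eq_bigr => i _; ring.
    by rewrite -/B -/c; ring.
  by apply: sumr_ge0 => i _; exact: sqr_ge0.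
have [B0|B0] := eqVneq B 0; last first.
  have Bp : 0 < B by rewrite lt_neqAle eq_sym B0 dotp_ge0.
  by move: H; rewrite pmulr_rge0// subr_ge0.
suff -> : c = 0 by rewrite expr0n B0 mulr0.
have y0 i : y i 0 = 0.
  apply/eqP; rewrite -sqrf_eq0; apply/eqP.
  have h : \sum_(j < d) y j 0 ^+ 2 = 0.
    by rewrite -[RHS]B0; apply: eq_bigr => j _; rewrite expr2.
  exact: (psumr_eq0P (fun j _ => sqr_ge0 (y j 0)) h).
by rewrite /c /dotp big1// => i _; rewrite y0 mulr0.
Qed.

Lemma enormD_le x y : enorm (x + y) <= enorm x + enorm y.
Proof.
rewrite -(@ler_pXn2r _ 2) ?nnegrE ?addr_ge0 ?enorm_ge0//.
rewrite sqr_enormD; have := le_trans (ler_norm _) (cauchy_schwarz x y).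
by move=> ?; rewrite sqrrD; lra.
Qed.

Lemma ler_coord_enorm x i : `|x i 0| <= enorm x.
Proof.
rewrite -(@ler_pXn2r _ 2) ?nnegrE ?enorm_ge0// real_normK ?num_real//.
rewrite sqr_enorm /dotp (bigD1 i)//= -expr2 lerDl.
by apply: sumr_ge0 => j _; rewrite -expr2 sqr_ge0.
Qed.

Lemma enorm_gt0 x : x != 0 -> 0 < enorm x.
Proof.
move=> x0; rewrite lt_neqAle enorm_ge0 andbT eq_sym; apply: contraNneq x0 => x0.
apply/eqP/matrixP => i j; rewrite ord1 mxE; apply/eqP.
by rewrite -normr_eq0 eq_le normr_ge0 andbT -x0 ler_coord_enorm.
Qed.

Lemma enorm0 : enorm (0 : 'cV[R]_d) = 0.
Proof.
rewrite /enorm big1 ?sqrtr0// => i _.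
by rewrite mxE expr0n.
Qed.

Lemma sphere_hat x : x != 0 -> sphere (hat x).
Proof.
move=> x0; have xp := enorm_gt0 x0; rewrite /sphere/= /hat (negbTE x0).
apply/eqP; rewrite -(@eqrXn2 _ 2) ?enorm_ge0// sqr_enorm expr1n.
have -> : dotp ((enorm x)^-1 *: x) ((enorm x)^-1 *: x) =
    (enorm x)^-1 ^+ 2 * enorm x ^+ 2.
  rewrite sqr_enorm /dotp mulr_sumr; apply: eq_bigr => i _.
  by rewrite !mxE; ring.
by rewrite -exprMn mulVf ?expr1n// gt_eqF.
Qed.

Lemma quadE A u : (u^T *m A *m u) 0 0 = dotp u (A *m u).
Proof. by rewrite -mulmxA mxE; apply: eq_bigr => i _; rewrite mxE. Qed.

(** Any finite bound would do: [opnorm] is a real [sup], and it dominates the values on the sphere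
    only if these are bounded above. *)
Lemma enorm_mulmx_le A u : sphere u ->
  enorm (A *m u) <= Num.sqrt (\sum_(i < d) (\sum_(j < d) `|A i j|) ^+ 2).
Proof.
move=> su; rewrite ler_wsqrtr//; apply: ler_sum => i _.
rewrite -real_normK ?num_real// lerXn2r ?nnegrE ?sumr_ge0//.
rewrite mxE (le_trans (ler_norm_sum _ _ _))//; apply: ler_sum => j _.
by rewrite normrM ler_piMr// -su ler_coord_enorm.
Qed.

Lemma opnorm_ge A u : sphere u -> enorm (A *m u) <= opnorm A.
Proof.
move=> su; apply: ub_le_sup; last by exists u.
exists (Num.sqrt (\sum_(i < d) (\sum_(j < d) `|A i j|) ^+ 2)) => _ [v sv <-].
exact: enorm_mulmx_le.
Qed.

Lemma quad_opnorm A u : sphere u -> `|(u^T *m A *m u) 0 0| <= opnorm A.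
Proof.
move=> su; rewrite quadE (le_trans (cauchy_schwarz _ _))//.
by rewrite su mul1r opnorm_ge.
Qed.

(** Each diagonal entry is the quadratic form at a standard basis vector. *)
Lemma trace_opnorm A : `|\tr A| <= d%:R * opnorm A.
Proof.
rewrite /mxtrace (le_trans (ler_norm_sum _ _ _))//.
rewrite mulr_natl -[X in _ *+ X](card_ord d) -sumr_const.
apply: ler_sum => i _; pose e : 'cV[R]_d := delta_mx i 0.
have se : sphere e.
  rewrite /sphere /= /enorm (bigD1 i)//= big1 ?addr0.
    by rewrite mxE !eqxx expr1n sqrtr1.
  by move=> j ji; rewrite mxE (negbTE ji) expr0n.
have <- : (e^T *m A *m e) 0 0 = A i i.
  by rewrite trmx_delta -rowE -colE !mxE.
exact: quad_opnorm.
Qed.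

Lemma quad_hat A x : x != 0 ->
  (x^T *m A *m x) 0 0 = enorm x ^+ 2 * ((hat x)^T *m A *m hat x) 0 0.
Proof.
move=> x0; have xp := enorm_gt0 x0.
have E : x = enorm x *: hat x.
  by rewrite /hat (negbTE x0) scalerA mulfV ?gt_eqF// scale1r.
rewrite !quadE /dotp mulr_sumr; apply: eq_bigr => i _.
have -> : A *m x = enorm x *: (A *m hat x) by rewrite {1}E -scalemxAr.
by rewrite {1}E !mxE; ring.
Qed.

End euclidean_facts.

(** * Increments relative to the bracket of the current point *)

Section relative_increments.
Context {R : realType} {d : nat}.
Implicit Types x D : 'cV[R]_d.

(* The square of the Japanese bracket. *)
Definition jsq x : R := 1 + enorm x ^+ 2.

Lemma jsq_ge1 x : 1 <= jsq x. Proof. by rewrite lerDl sqr_ge0. Qed.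

Lemma jsq_gt0 x : 0 < jsq x. Proof. exact: lt_le_trans (jsq_ge1 x). Qed.

Lemma enorm_le_jsq x : enorm x <= jsq x.
Proof. by rewrite /jsq; have := enorm_ge0 x; set n := enorm x; nra. Qed.

Definition rel_dot x D : R := dotp x D / jsq x.

Definition rel_norm x D : R := enorm D * jsq x `^ (- 2^-1).

Lemma rel_normE x D : rel_norm x D ^+ 2 = enorm D ^+ 2 / jsq x.
Proof.
rewrite exprMn; congr (_ * _); rewrite -powR_mulrn ?powR_ge0// -powRrM.
by rewrite mulNr mulVf// powR_inv1// (ltW (jsq_gt0 x)).
Qed.

Lemma rel_dot_le x D : `|rel_dot x D| <= rel_norm x D.
Proof.
have s0 := jsq_gt0 x.
rewrite -(@ler_pXn2r _ 2) ?nnegrE ?mulr_ge0 ?enorm_ge0 ?powR_ge0//.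
rewrite rel_normE real_normK ?num_real// expr_div_n ler_pdivrMr ?exprn_gt0//.
rewrite [jsq x ^+ 2]expr2 mulrA divfK ?gt_eqF// mulrC.
apply: (@le_trans _ _ (enorm x ^+ 2 * enorm D ^+ 2)).
  rewrite -exprMn -(@real_normK _ (dotp x D)) ?num_real//.
  by rewrite lerXn2r ?nnegrE ?mulr_ge0 ?enorm_ge0// cauchy_schwarz.
by rewrite ler_wpM2r ?sqr_ge0// lerDr.
Qed.

Lemma jsq_increment x D :
  jsq (x + D) = jsq x * (1 + (2 * rel_dot x D + rel_norm x D ^+ 2)).
Proof.
rewrite rel_normE /rel_dot {1}/jsq sqr_enormD.
have := jsq_gt0 x => /lt0r_neq0 s0.
rewrite mulrDr mulr1 mulrDr [jsq x * (2 * _)]mulrC.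
rewrite -mulrA [_ / jsq x * jsq x]divfK// [jsq x * (_ / _)]mulrC divfK//.
by rewrite /jsq; ring.
Qed.

Lemma one_increment_gt0 x D : 0 < 1 + (2 * rel_dot x D + rel_norm x D ^+ 2).
Proof. by rewrite -(pmulr_rgt0 _ (jsq_gt0 x)) -jsq_increment jsq_gt0. Qed.

Lemma rel_norm_powR p x D :
  rel_norm x D `^ p = enorm D `^ p * jsq x `^ (- (p / 2)).
Proof.
rewrite powRM ?enorm_ge0 ?powR_ge0// -powRrM; congr (_ * _ `^ _).
by field.
Qed.

End relative_increments.

(** * Means of quadratic polynomials in the increment *)

Section quadratic_moments.
Context {R : realType} {d : nat} {disp : measure_display}.
Context {T : measurableType disp} (mu : {measure set T -> \bar R}).
Hypothesis mu1 : mu setT = 1%E.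

(** Integrability and value travel together, so that the mean of a polynomial can be assembled term
    by term without repeated integrability side conditions. *)
Definition has_mean (h : T -> R) (v : R) :=
  mu.-integrable setT (EFin \o h) /\ (\int[mu]_t h t = v)%R.

Lemma has_mean_cst (k : R) : has_mean (fun=> k) k.
Proof.
split; last by rewrite Rintegral_cst// mu1 mulr1.
apply/integrableP; split; first exact: measurable_cst.
under eq_integral do rewrite /=.
by rewrite integral_cst// mu1 mule1 ltry.
Qed.

Lemma has_meanD h1 h2 v1 v2 : has_mean h1 v1 -> has_mean h2 v2 ->
  has_mean (fun t => h1 t + h2 t) (v1 + v2).
Proof.
move=> [i1 <-] [i2 <-]; split; last exact: RintegralD.
by have := integrableD measurableT i1 i2.
Qed.

Lemma has_meanZ k h v : has_mean h v -> has_mean (fun t => k * h t) (k * v).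
Proof.
move=> [i <-]; split; last exact: RintegralZl.
by have := integrableZl measurableT k i.
Qed.

Lemma has_mean_sum n (h : 'I_n -> T -> R) v :
  (forall i, has_mean (h i) (v i)) ->
  has_mean (fun t => \sum_(i < n) h i t) (\sum_(i < n) v i).
Proof.
elim: n h v => [|n IH] h v hv.
  rewrite big_ord0; under [X in has_mean X]eq_fun do rewrite big_ord0.
  exact: has_mean_cst.
rewrite big_ord_recl; under [X in has_mean X]eq_fun do rewrite big_ord_recl.
by apply: has_meanD => //; apply: IH => i.
Qed.

Lemma has_mean_eq h1 h2 v1 v2 :
  h1 =1 h2 -> v1 = v2 -> has_mean h1 v1 -> has_mean h2 v2.
Proof. by move=> /funext -> ->. Qed.

(** The left-hand side is an extended-real integral of a nonnegative function, so its finiteness is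
    a result of the bound. *)
Lemma has_mean_ge (f h : T -> R) v :
  measurable_fun setT f -> (forall t, 0 <= f t) ->
  (forall t, f t <= h t) -> has_mean h v -> (\int[mu]_t (f t)%:E <= v%:E)%E.
Proof.
move=> mf f0 fh [ih <-].
apply: (@le_trans _ _ (\int[mu]_t (h t)%:E)%E).
  apply: ge0_le_integral => //.
  - by move=> t _; rewrite lee_fin.
  - exact/measurable_EFinP.
  - exact: measurable_int ih.
  - by move=> t _; rewrite lee_fin.
rewrite /Rintegral fineK//.
exact: (integrable_fin_num _ ih).
Qed.

Variable D : T -> 'cV[R]_d.
Hypothesis mD : forall i, measurable_fun setT (fun t => D t i 0).

Lemma measurable_enorm : measurable_fun setT (fun t => enorm (D t)).
Proof.
have ms := continuous_measurable_fun (@sqrt_continuous R).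
apply: (measurableT_comp ms).
by apply: measurable_sum => i; exact: measurable_funX.
Qed.

Variables (p B : R).
Hypothesis p2 : 2 <= p.
Hypothesis pB : (\int[mu]_t (enorm (D t) `^ p)%:E <= B%:E)%E.

Let mqp : measurable_fun setT (fun t => enorm (D t) `^ p).
Proof. exact: measurableT_comp (measurable_powR p) measurable_enorm. Qed.

Let iqp : mu.-integrable setT (EFin \o (fun t => enorm (D t) `^ p)).
Proof.
apply/integrableP; split; first exact/measurable_EFinP.
rewrite (le_lt_trans _ (ltry B))//; apply: le_trans pB.
apply: ge0_le_integral => //.
- by apply: measurableT_comp => //; exact/measurable_EFinP.
- exact/measurable_EFinP.
- by move=> t _ /=; rewrite lee_fin ger0_norm// powR_ge0.
Qed.

Lemma sqr_le_1DpowR (q : R) : 0 <= q -> q ^+ 2 <= 1 + q `^ p.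
Proof.
move=> q0; have [q1|/ltW q1] := leP q 1.
  by rewrite (@le_trans _ _ 1) ?exprn_ile1// lerDl powR_ge0.
rewrite -powR_mulrn// (@le_trans _ _ (q `^ p))//; last by rewrite lerDr.
exact: ler_powR.
Qed.

Lemma has_mean_dominated (h : T -> R) (c : R) : measurable_fun setT h ->
  (forall t, `|h t| <= c * (1 + enorm (D t) ^+ 2)) ->
  has_mean h (\int[mu]_t h t)%R.
Proof.
move=> mh hc; split=> //.
(* The dominating function is 2 |c| (1 + q^p) with q the norm, because q^2 <= 1 + q^p. *)
have [i1 _] := has_meanZ (`|c| * 2)
  (has_meanD (has_mean_cst 1) (conj iqp erefl)).
apply: le_integrable i1 => //; first exact/measurable_EFinP.
move=> t _; rewrite /= lee_fin (le_trans (hc t))// (le_trans (ler_norm _))//.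
rewrite !normrM normr_id -mulrA ler_wpM2l//.
rewrite !ger0_norm ?addr_ge0 ?powR_ge0 ?sqr_ge0//.
have := sqr_le_1DpowR (enorm_ge0 (D t)); have := powR_ge0 (enorm (D t)) p; lra.
Qed.

Lemma has_mean_powR : exists2 b, b <= B &
  has_mean (fun t => enorm (D t) `^ p) b.
Proof.
exists (\int[mu]_t enorm (D t) `^ p)%R; last by split.
rewrite -lee_fin /Rintegral fineK//.
exact: (integrable_fin_num _ iqp).
Qed.

Lemma has_mean_coord i : has_mean (fun t => D t i 0) (\int[mu]_t D t i 0)%R.
Proof.
apply: (@has_mean_dominated _ 1) => // t.
have := ler_coord_enorm (D t) i; set q := enorm _; set e := `|_|; nra.
Qed.

Lemma has_mean_coordM i j :
  has_mean (fun t => D t i 0 * D t j 0) (\int[mu]_t (D t i 0 * D t j 0))%R.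
Proof.
apply: (@has_mean_dominated _ 1); first exact: measurable_funM.
move=> t; rewrite normrM mul1r.
rewrite (@le_trans _ _ (enorm (D t) * enorm (D t)))//.
  by rewrite ler_pM// ler_coord_enorm.
by rewrite -expr2 lerDr.
Qed.

Lemma has_mean_quadratic (x m : 'cV[R]_d) (M : 'M[R]_d) (a b c e : R) :
  (forall i, m i 0 = (\int[mu]_t D t i 0)%R) ->
  (forall i j, M i j = (\int[mu]_t (D t i 0 * D t j 0))%R) ->
  has_mean (fun t => a + b * dotp x (D t) + c * enorm (D t) ^+ 2 +
      e * dotp x (D t) ^+ 2)
    (a + b * dotp x m + c * \tr M + e * (x^T *m M *m x) 0 0).
Proof.
move=> mE ME.
apply: has_meanD; [apply: has_meanD; [apply: has_meanD|]|].
- exact: has_mean_cst.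
- apply: has_meanZ; apply: has_mean_sum => i; apply: has_meanZ.
  by rewrite mE; exact: has_mean_coord.
- apply: has_meanZ.
  apply: has_mean_eq (has_mean_sum (fun i => has_mean_coordM i i)).
    by move=> t; rewrite sqr_enorm.
  by apply: eq_bigr => i _; rewrite ME.
- apply: has_meanZ.
  apply: has_mean_eq (has_mean_sum (fun i => has_mean_sum (fun j =>
    has_meanZ (x i 0 * x j 0) (has_mean_coordM i j)))).
    move=> t; rewrite expr2 /dotp mulr_suml; apply: eq_bigr => i _.
    by rewrite mulr_sumr; apply: eq_bigr => j _; ring.
  rewrite quadE /dotp; apply: eq_bigr => i _.
  by rewrite mxE mulr_sumr; apply: eq_bigr => j _; rewrite ME; ring.
Qed.

(* A pointwise second-order bound with remainder of order [p] can be
   integrated without any moment beyond the [p]-th one. *)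
Lemma integral_quadratic_le (f : T -> R) (x m : 'cV[R]_d) (M : 'M[R]_d)
    (a b c e g : R) :
  (forall i, m i 0 = (\int[mu]_t D t i 0)%R) ->
  (forall i j, M i j = (\int[mu]_t (D t i 0 * D t j 0))%R) ->
  measurable_fun setT f -> (forall t, 0 <= f t) -> 0 <= g ->
  (forall t, f t <= a + b * dotp x (D t) + c * enorm (D t) ^+ 2 +
      e * dotp x (D t) ^+ 2 + g * enorm (D t) `^ p) ->
  (\int[mu]_t (f t)%:E <= (a + b * dotp x m + c * \tr M +
    e * (x^T *m M *m x) 0 0 + g * B)%:E)%E.
Proof.
move=> mE ME mf f0 g0 fle; have [r rB hr] := has_mean_powR.
apply: (@le_trans _ _ (a + b * dotp x m + c * \tr M +
    e * (x^T *m M *m x) 0 0 + g * r)%:E); last first.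
  by rewrite lee_fin lerD2l ler_wpM2l.
apply: has_mean_ge fle _ => //.
by apply: has_meanD; [exact: has_mean_quadratic|exact: has_meanZ].
Qed.

End quadratic_moments.

(** * Markov property for nonnegative measurable functions *)

Section markov_property.
Context {R : realType} {d : nat} {disp : measure_display}.
Context {Omega : measurableType disp} (P : probability Omega R).
Context (S : set 'cV[R]_d) (K : R.-pker (borel_cV R d) ~> (borel_cV R d)).
Context (x0 : 'cV[R]_d) (X : nat -> Omega -> borel_cV R d).
Hypothesis hX : markov_process P S K x0 X.

Lemma measurable_history n A : history X n A -> measurable A.
Proof.
apply: smallest_sub; first exact: sigma_algebra_measurable.
by move=> _ [k kn] [B mB <-]; exact: (mp_measurable hX).
Qed.

Lemma history_preimage n k B : (k <= n)%N -> measurable B ->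
  history X n (X k @^-1` B).
Proof.
move=> kn mB; apply: sub_sigma_algebra; exists k => //.
by exists B => //; rewrite setTI.
Qed.

Lemma sub_history m n : (m <= n)%N -> history X m `<=` history X n.
Proof.
move=> mn; apply: sub_sigma_algebra2 => A [k km hA].
by exists k => //; exact: leq_trans mn.
Qed.

Lemma historyI n A B : history X n A -> history X n B -> history X n (A `&` B).
Proof. exact: (@measurableI _ (g_sigma_algebraType _)). Qed.

Lemma historyT n : history X n setT.
Proof. exact: (@measurableT _ (g_sigma_algebraType _)). Qed.

Lemma measurable_kernel_state n B : measurable B ->
  measurable_fun setT (fun w => K (X n w) B).
Proof.
move=> mB.
exact: measurableT_comp (measurable_kernel K B mB) (mp_measurable hX n).
Qed.

Import HBNNSimple.

(** [mp_markov] is the case of an indicator; simple functions follow by linearity over their level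
    sets. *)
Let markov_nnsfun n A (g : {nnsfun (borel_cV R d) >-> R}) : history X n A ->
  (\int[P]_(w in A) (g (X n.+1 w))%:E =
   \int[P]_(w in A) (\int[K (X n w)]_z (g z)%:E))%E.
Proof.
move=> hA; have mA := measurable_history hA.
have mX := mp_measurable hX n.+1.
under [in LHS]eq_integral do rewrite fimfunE -fsumEFin//.
rewrite ge0_integral_fsum//; last 2 first.
- move=> r; apply/measurable_EFinP; apply: measurable_funM => //.
  apply: measurable_funTS.
  exact: (measurableT_comp (measurable_indic _) mX).
- by move=> r w _; exact: nnfun_muleindic_ge0.
have -> : (fun w => \int[K (X n w)]_z (g z)%:E)%E =
    (fun w => \sum_(r \in range g) (r%:E * K (X n w) (g @^-1` [set r])))%E.
  by apply/funext => w; rewrite integralT_nnsfun sintegralE.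
rewrite /= ge0_integral_fsum//; last 2 first.
- move=> r; apply: measurable_funeM; apply: measurable_funTS.
  exact: measurable_kernel_state.
- move=> r w _.
  apply: (mulemu_ge0 (fun r => g @^-1` [set r])) => r0.
  exact: preimage_nnfun0.
apply: eq_fsbigr => r _.
(* Scalars are pulled out of integrals only when they are nonnegative; a negative r has an empty
   level set, so both sides vanish. *)
have [r0|r0] := ltP r 0.
  rewrite !integral0_eq// => w _; rewrite preimage_nnfun0// ?measure0 ?mule0//.
  by rewrite indic0 mulr0.
have mi : measurable_fun A
    (fun w => (\1_(g @^-1` [set r]) (X n.+1 w))%:E : \bar R).
  apply/measurable_EFinP; apply: measurable_funTS.
  exact: (measurableT_comp (measurable_indic _) mX).
transitivity (r%:E *
    \int[P]_(w in A) (\1_(g @^-1` [set r]) (X n.+1 w))%:E)%E.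
  by rewrite -ge0_integralZl// => w _; rewrite lee_fin.
rewrite ge0_integralZl//; last first.
  by apply: measurable_funTS; exact: measurable_kernel_state.
congr (_ * _)%E.
transitivity (P (A `&` X n.+1 @^-1` (g @^-1` [set r]))); last first.
  by apply: (mp_markov hX).
have -> : (fun w => (\1_(g @^-1` [set r]) (X n.+1 w))%:E) =
  (fun w => (\1_(X n.+1 @^-1` (g @^-1` [set r])) w)%:E :> \bar R) by [].
rewrite integral_indic//; last by rewrite -[X in measurable X]setTI; exact: mX.
by rewrite setIC.
Qed.

(** Monotone convergence along simple approximations, used once on the left and twice on the right:
    inside the kernel integral, then outside. *)
Lemma markov_integral n A (f : borel_cV R d -> \bar R) : history X n A ->
  measurable_fun setT f -> (forall z, 0 <= f z)%E ->
  (\int[P]_(w in A) f (X n.+1 w) =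
   \int[P]_(w in A) (\int[K (X n w)]_z f z))%E.
Proof.
move=> hA mf f0; have mA := measurable_history hA.
have mX := mp_measurable hX n.+1.
pose g := nnsfun_approx measurableT mf.
have g0 k z : (0 <= (g k z)%:E)%E by rewrite lee_fin.
have mg k : measurable_fun setT (fun z => (g k z)%:E : \bar R).
  exact/measurable_EFinP.
have ndg z : nondecreasing_seq (fun k => (g k z)%:E : \bar R).
  by move=> a b ab; rewrite lee_fin; exact/lefP/nd_nnsfun_approx.
have limg z : limn (fun k => (g k z)%:E : \bar R) = f z.
  by apply/cvg_lim => //; exact: cvg_nnsfun_approx.
have mgX k : measurable_fun A (fun w => (g k (X n.+1 w))%:E : \bar R).
  by apply: measurable_funTS; exact: measurableT_comp (mg k) mX.
have mK k : measurable_fun A (fun w => \int[K (X n w)]_z (g k z)%:E)%E.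
  apply: measurable_funTS.
  apply: (@measurableT_comp _ _ _ _ _ _
    (fun x => \int[K x]_z (g k z)%:E)%E) (mp_measurable hX n).
  apply: measurable_fun_integral_kernel => // U mU.
  exact: measurable_kernel.
transitivity (\int[P]_(w in A) limn (fun k => (g k (X n.+1 w))%:E))%E.
  by apply: eq_integral => w _; rewrite limg.
rewrite monotone_convergence//.
transitivity (\int[P]_(w in A)
    limn (fun k => \int[K (X n w)]_z (g k z)%:E))%E; last first.
  apply: eq_integral => w _.
  rewrite -monotone_convergence//.
  by apply: eq_integral => z _; rewrite limg.
rewrite monotone_convergence//; last 2 first.
- by move=> k w _; apply: integral_ge0.
- move=> w _ a b ab; apply: ge0_le_integral => //.
  by move=> z _; exact: ndg.
by congr (limn _); apply/funext => k; rewrite markov_nnsfun.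
Qed.

End markov_property.

(** * Supermartingale estimates for exits from a set *)

Section exit_estimates.
Context {R : realType} {d : nat} {disp : measure_display}.
Context {Omega : measurableType disp} (P : probability Omega R).
Context (S : set 'cV[R]_d) (K : R.-pker (borel_cV R d) ~> (borel_cV R d)).
Context (x0 : 'cV[R]_d) (X : nat -> Omega -> borel_cV R d).
Hypothesis hX : markov_process P S K x0 X.
Implicit Types (A : set Omega) (D E : set (borel_cV R d)).

(* The walk is in [D] at the [j + 1] times [m, ..., j + m]; writing [j + m]
   rather than [m + j] lets [j.+1 + m] reduce to [(j + m).+1]. *)
Fixpoint stay A m D j : set Omega :=
  if j is i.+1 then stay A m D i `&` X (i + m).+1 @^-1` D
  else A `&` X m @^-1` D.

Definition exit A m D E j := stay A m D j `&` X (j + m).+1 @^-1` E.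

Lemma stayP A m D j w :
  stay A m D j w <-> A w /\ forall k, (k <= j)%N -> D (X (k + m) w).
Proof.
elim: j => [|j IH] /=.
  split=> [[Aw Dw]|[Aw h]]; split=> //; last exact: (h 0%N).
  by move=> k; rewrite leqn0 => /eqP ->.
split=> [[/IH[Aw h] Dw]|[Aw h]].
  by split=> // k; rewrite leq_eqVlt ltnS => /predU1P[->//|]; exact: h.
split; last exact: (h j.+1).
by apply/IH; split=> // k kj; apply: h; exact: leqW.
Qed.

Lemma history_stay A m D j : history X m A -> measurable D ->
  history X (j + m) (stay A m D j).
Proof.
move=> hA mD; elim: j => [|j IH] /=.
  by apply: historyI => //; exact: history_preimage.
apply: historyI; last exact: history_preimage.
by apply: sub_history IH; exact: leqnSn.
Qed.

Lemma measurable_state n D : measurable D -> measurable (X n @^-1` D).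
Proof.
by move=> mD; rewrite -[X in measurable X]setTI; exact: (mp_measurable hX).
Qed.

Lemma measurable_stay A m D j : history X m A -> measurable D ->
  measurable (stay A m D j).
Proof.
by move=> hA mD; apply: (measurable_history hX); exact: history_stay.
Qed.

Lemma measurable_exit A m D E j : history X m A -> measurable D ->
  measurable E -> measurable (exit A m D E j).
Proof.
move=> hA mD mE; apply: measurableI; first exact: measurable_stay.
exact: measurable_state.
Qed.

(** The first time outside [D] has the form (j + m) + 1, because the walk is in [D] at time m. *)
Lemma exit_exists A m D w : A w -> D (X m w) ->
  (exists2 k, (m <= k)%N & ~ D (X k w)) ->
  exists2 j, stay A m D j w & ~ D (X (j + m).+1 w).
Proof.
move=> Aw Dw [k mk nDk].
have ex : exists j, `[< ~ D (X (j + m) w) >].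
  by exists (k - m)%N; apply/asboolP; rewrite subnK.
have [[|j] /asboolP nD jmin] := ex_minnP ex; first by case: nD.
exists j => //; apply/stayP; split=> // i ij.
apply: contrapT => /asboolP /jmin; rewrite leqNgt; apply/negP.
by rewrite negbK ltnS.
Qed.

(** Optional stopping at a finite horizon, by induction on n. At each step the mass of [f] on the
    paths still in [D] pays [e] for the drift, then splits between the paths that remain in [D] and
    those that enter [E], where [f] is at least [c]. *)
Lemma exit_ineq A m D E (f : borel_cV R d -> R) (c e : R) n :
  history X m A -> measurable D -> measurable E -> D `&` E = set0 ->
  measurable_fun setT f -> (forall z, 0 <= f z) -> 0 <= c -> 0 <= e ->
  (forall z, E z -> c <= f z) ->
  (forall x, S x -> D x -> (\int[K x]_z (f z)%:E + e%:E <= (f x)%:E)%E) ->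
  (\int[P]_(w in stay A m D n) (f (X (n + m) w))%:E +
   \sum_(j < n) (c%:E * P (exit A m D E j) + e%:E * P (stay A m D j))
   <= \int[P]_(w in stay A m D 0%N) (f (X m w))%:E)%E.
Proof.
move=> hA mD mE DE mf f0 c0 e0 fE super.
have mfX k : measurable_fun setT (fun w => (f (X k w))%:E : \bar R).
  by apply/measurable_EFinP; exact: measurableT_comp mf (mp_measurable hX k).
have f0E k w : (0 <= (f (X k w))%:E)%E by rewrite lee_fin.
elim: n => [|n IH]; first by rewrite big_ord0 adde0.
apply: le_trans IH; rewrite big_ord_recr /= addeC -addeA addeC leeD2r//.
set G := stay A m D n.
have mG : measurable G by exact: measurable_stay.
have hG : history X (n + m) G by exact: history_stay.
have mfK : measurable_fun setT (fun x => \int[K x]_z (f z)%:E)%E.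
  apply: measurable_fun_integral_kernel => //.
  - exact: measurable_kernel.
  - exact/measurable_EFinP.
have mfKX : measurable_fun setT (fun w => \int[K (X (n + m) w)]_z (f z)%:E)%E.
  exact: (measurableT_comp mfK (mp_measurable hX _)).
apply: (@le_trans _ _
   (\int[P]_(w in G) (\int[K (X (n + m) w)]_z (f z)%:E + e%:E))%E); last first.
  apply: ge0_le_integral => //.
  - by move=> w _; rewrite adde_ge0// integral_ge0// => z _; rewrite lee_fin.
  - by apply: emeasurable_funD => //; exact: measurable_funTS.
  - exact: measurable_funTS.
  - move=> w Gw; apply: super; first exact: (mp_state hX).
    by have [_ /(_ n (leqnn n))] := (stayP A m D n w).1 Gw.
rewrite ge0_integralD//; last 2 first.
- by move=> w _; apply: integral_ge0 => z _; rewrite lee_fin.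
- exact: measurable_funTS.
rewrite integral_cst// addeAC leeD2r//.
rewrite -(markov_integral hX hG)//; last exact/measurable_EFinP.
have m1 : measurable (stay A m D n.+1) by exact: measurable_stay.
have m2 : measurable (exit A m D E n) by exact: measurable_exit.
(* Paths that leave [D] without entering [E] are dropped, which is allowed as [f] is nonnegative. *)
apply: (@le_trans _ _ (\int[P]_(w in stay A m D n.+1 `|` exit A m D E n)
    (f (X (n + m).+1 w))%:E)%E); last first.
  apply: ge0_subset_integral => //.
  - exact: measurableU.
  - exact: measurable_funTS.
  - by move=> w [] [].
rewrite ge0_integral_setU//; last 2 first.
- exact: measurable_funTS.
- apply/disj_setPS => w [[_ Dw] [_ Ew]].
  by rewrite -[set0 w]/((set0 : set (borel_cV R d)) (X (n + m).+1 w)) -DE.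
rewrite addeC leeD2l// -integral_cst//.
apply: ge0_le_integral => //.
- exact: measurable_funTS.
- by move=> w [_ Ew]; rewrite lee_fin fE.
Qed.

(** Paths that stay forever pay [e] at every step, so n e P(F) <= b for all n. The exit terms are
    switched off by an empty target and c = 0. *)
Lemma stay_forever0 m D (f : borel_cV R d -> R) (b e : R) :
  measurable D -> measurable_fun setT f -> (forall z, 0 <= f z <= b) ->
  0 < e ->
  (forall x, S x -> D x -> (\int[K x]_z (f z)%:E + e%:E <= (f x)%:E)%E) ->
  P (\bigcap_j stay setT m D j) = 0%E.
Proof.
move=> mD mf fb e0 super; set F := \bigcap_j _.
have hT : history X m setT by exact: historyT.
have mF : measurable F.
  by apply: bigcapT_measurable => j; exact: measurable_stay.
have mG0 : measurable (stay setT m D 0) by exact: measurable_stay.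
have mfX : measurable_fun setT (fun w => (f (X m w))%:E : \bar R).
  by apply/measurable_EFinP; exact: measurableT_comp mf (mp_measurable hX m).
have b0 : 0 <= b by have /andP[/le_trans] := fb point; apply.
have H n : (n%:R%:E * (e%:E * P F) <= b%:E)%E.
  have := @exit_ineq setT m D set0 f 0 e n hT mD measurable0 (setI0 _) mf
    (fun z => proj1 (andP (fb z))) (lexx _) (ltW e0) (fun z => False_ind _)
    super.
  move=> h; apply: (@le_trans _ _
      (\int[P]_(w in stay setT m D 0) (f (X m w))%:E)%E).
    apply: le_trans h; rewrite -[leLHS]add0e leeD//.
      apply: integral_ge0 => w _.
      by rewrite lee_fin; case/andP: (fb (X (n + m) w)).
    have -> : (n%:R%:E * (e%:E * P F) = \sum_(j < n) (e%:E * P F))%E.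
      by rewrite sumr_const card_ord mule_natl.
    apply: lee_sum => j _; rewrite mul0e add0e lee_wpmul2l//.
      by rewrite lee_fin ltW.
    apply: le_measure; rewrite ?inE//; first exact: measurable_stay.
    exact: bigcap_inf.
  apply: (@le_trans _ _ (\int[P]_(w in stay setT m D 0) b%:E)%E).
    apply: ge0_le_integral => //.
    - by move=> w _; rewrite lee_fin; case/andP: (fb (X m w)).
    - exact: measurable_funTS.
    - by move=> w _; rewrite lee_fin; case/andP: (fb (X m w)).
  rewrite integral_cst// -[leRHS]mule1 lee_wpmul2l ?lee_fin//.
  exact: probability_le1.
have PF : P F \is a fin_num by exact: fin_num_measure.
move: H; rewrite -(fineK PF) => H.
have p0 : 0 <= fine (P F) by exact: fine_ge0.
congr EFin; apply/eqP; rewrite eq_le p0 andbT leNgt; apply/negP => p1.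
have ep : 0 < e * fine (P F) by rewrite mulr_gt0.
have := H (Num.trunc (b / (e * fine (P F)))).+1.
rewrite -!EFinM lee_fin -ler_pdivlMr// leNgt => /negP; apply.
exact: truncnS_gt.
Qed.

(** Markov's inequality for the value of [f] on entering [E]. The factor [P A] on the right lets the
    bound be summed over disjoint starting events. *)
Lemma exit_le A m D E (f : borel_cV R d -> R) (b c : R) :
  history X m A -> measurable D -> measurable E -> D `&` E = set0 ->
  measurable_fun setT f -> (forall z, 0 <= f z) -> 0 < c ->
  (forall w, A w -> f (X m w) <= b) ->
  (forall z, E z -> c <= f z) ->
  (forall x, S x -> D x -> (\int[K x]_z (f z)%:E <= (f x)%:E)%E) ->
  (\sum_(j <oo) P (exit A m D E j) <= (b / c)%:E * P A)%E.
Proof.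
move=> hA mD mE DE mf f0 c0 fb fE super.
have mA := measurable_history hX hA.
have mG0 : measurable (stay A m D 0) by exact: measurable_stay.
have mfX : measurable_fun setT (fun w => (f (X m w))%:E : \bar R).
  by apply/measurable_EFinP; exact: measurableT_comp mf (mp_measurable hX m).
apply: lime_le; first by apply: is_cvg_nneseries.
apply: nearW => n; rewrite big_mkord.
have super' x : S x -> D x -> (\int[K x]_z (f z)%:E + 0%:E <= (f x)%:E)%E.
  by rewrite adde0; exact: super.
have := @exit_ineq A m D E f c 0 n hA mD mE DE mf f0 (ltW c0) (lexx _) fE
  super'.
set I0 := (\int[P]_(w in _) (f (X m w))%:E)%E => h.
have h1 : (c%:E * \sum_(j < n) P (exit A m D E j) <= I0)%E.
  apply: le_trans h; rewrite -[leLHS]add0e leeD//.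
    by apply: integral_ge0 => w _; rewrite lee_fin.
  rewrite ge0_sume_distrr//; apply: lee_sum => j _.
  by rewrite mul0e adde0.
have h2 : (I0 <= b%:E * P A)%E.
  rewrite -integral_cst//; apply: (@le_trans _ _
      (\int[P]_(w in stay A m D 0) b%:E)%E).
    apply: ge0_le_integral => //.
    - by move=> w _; rewrite lee_fin.
    - exact: measurable_funTS.
    - by move=> w [Aw _]; rewrite lee_fin fb.
  apply: ge0_subset_integral => //.
  - by move=> w Aw; rewrite lee_fin; apply: le_trans (fb _ Aw).
  - by move=> w [].
rewrite mulrC EFinM -muleA -(@lee_pmul2l _ c%:E) ?lte_fin//.
rewrite muleA -EFinM mulfV ?gt_eqF// mul1e.
exact: le_trans h1 h2.
Qed.

End exit_estimates.

(** * Lyapunov criteria for transience and recurrence *)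

Section criteria.
Context {R : realType} {d : nat} {disp : measure_display}.
Context {Omega : measurableType disp} (P : probability Omega R).
Context (S : set 'cV[R]_d) (K : R.-pker (borel_cV R d) ~> (borel_cV R d)).
Context (x0 : 'cV[R]_d) (X : nat -> Omega -> borel_cV R d).
Hypothesis hX : markov_process P S K x0 X.
Implicit Types (A : set Omega) (D E : set (borel_cV R d)).

Lemma measurable_coord (i : 'I_d) :
  measurable_fun setT (fun x : borel_cV R d => (x : 'cV[R]_d) i 0).
Proof.
apply: (measurability _ (RGenOpens.measurableE R)) => _ [B [a [b ->]] <-].
rewrite setTI; apply: sub_sigma_algebra.
have /continuousP := @coord_continuous R d 1 i 0; apply; exact: interval_open.
Qed.

Lemma measurable_enorm_ge r :
  measurable [set x : borel_cV R d | r <= enorm (x : 'cV[R]_d)].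
Proof.
have := measurable_enorm measurable_coord measurableT
  (measurable_itv `[r, +oo[).
rewrite setTI; congr measurable; apply/seteqP.
by split=> x /=; rewrite in_itv /= andbT.
Qed.

Lemma measurable_enorm_gt r :
  measurable [set x : borel_cV R d | r < enorm (x : 'cV[R]_d)].
Proof.
have := measurable_enorm measurable_coord measurableT
  (measurable_itv `]r, +oo[).
rewrite setTI; congr measurable; apply/seteqP.
by split=> x /=; rewrite in_itv /= andbT.
Qed.

Lemma measurable_enorm_le r :
  measurable [set x : borel_cV R d | enorm (x : 'cV[R]_d) <= r].
Proof.
have := measurableC (measurable_enorm_gt r); congr measurable.
by apply/seteqP; split=> x /=; rewrite leNgt => /negP.
Qed.

Definition confined m r := [set w | forall k, (m <= k)%N -> enorm (X k w) <= r].

Hypothesis nonconfined : forall m r, P (confined m r) = 0%E.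

Lemma measurable_confined m r : measurable (confined m r).
Proof.
have -> : confined m r = \bigcap_k
    (X (k + m)%N @^-1` [set x : borel_cV R d | enorm (x : 'cV[R]_d) <= r]).
  apply/seteqP; split=> w /= h k; first by move=> _; apply: h; rewrite leq_addl.
  by move=> mk; have := h (k - m)%N I; rewrite /= subnK.
apply: bigcapT_measurable => k.
apply: (measurable_state hX); exact: measurable_enorm_le.
Qed.

Lemma unconfined_exists m r w : ~ confined m r w ->
  exists2 k, (m <= k)%N & r < enorm (X k w).
Proof.
move=> h; apply: contrapT => h'; apply: h => k mk.
by rewrite leNgt; apply/negP => rk; apply: h'; exists k.
Qed.

Section transience.
Variables (f : borel_cV R d -> R) (r0 : R).
Hypothesis mf : measurable_fun setT f.
Hypothesis f0 : forall x, 0 <= f x.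
Hypothesis f_low : forall r : R, exists2 c, 0 < c &
  forall x : borel_cV R d, enorm (x : 'cV[R]_d) <= r -> c <= f x.
Hypothesis f_vanish : forall e : R, 0 < e -> exists L : R,
  forall x : borel_cV R d, L <= enorm (x : 'cV[R]_d) -> f x <= e.
Hypothesis f_super : forall x, S x -> r0 < enorm x ->
  (\int[K x]_z (f z)%:E <= (f x)%:E)%E.

Let returns r := [set w | forall m, exists2 k, (m <= k)%N & enorm (X k w) <= r].

Let measurable_returns r : measurable (returns r).
Proof.
have -> : returns r = \bigcap_m \bigcup_k
    (X (k + m)%N @^-1` [set x : borel_cV R d | enorm (x : 'cV[R]_d) <= r]).
  apply/seteqP; split=> w /= h m.
    move=> _; have [k mk kr] := h m; exists (k - m)%N => //=.
    by rewrite subnK.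
  by have [k _ kr] := h m I; exists (k + m)%N => //; rewrite leq_addl.
apply: bigcapT_measurable => m; apply: bigcupT_measurable => k.
apply: (measurable_state hX); exact: measurable_enorm_le.
Qed.

(** By nonconfinement the walk reaches distance L almost surely, with L so large that f <= e c
    there. A later visit to the ball, where f >= c, then has probability at most e. Splitting by the
    first time of reaching L makes the bounds add up to e. *)
Let returns_small r e : r0 <= r -> 0 < e -> (P (returns r) <= e%:E)%E.
Proof.
move=> r0r e0; have [c c0 fc] := f_low r.
have [L0 fL] := f_vanish (mulr_gt0 e0 c0).
(* The r + 1 places the starting point strictly outside the ball, hence in [D]. *)
pose L := Num.max L0 (r + 1).
pose D := [set x : borel_cV R d | r < enorm (x : 'cV[R]_d)].
pose E := [set x : borel_cV R d | enorm (x : 'cV[R]_d) <= r].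
have mD : measurable D by exact: measurable_enorm_gt.
have mE : measurable E by exact: measurable_enorm_le.
have DE : D `&` E = set0.
  apply/seteqP; split=> // x [Dx Ex]; exfalso.
  by move: (lt_le_trans Dx Ex); rewrite ltxx.
pose F m := X m @^-1` [set x : borel_cV R d | L <= enorm (x : 'cV[R]_d)].
(* [A m] says that m is the first time at distance at least L: these events are disjoint, and [A m]
   depends on the first m + 1 states only. *)
pose A := seqDU F.
have hF k m : (k <= m)%N -> history X m (F k).
  by move=> km; apply: history_preimage => //; exact: measurable_enorm_ge.
have hA m : history X m (A m).
  apply: (@measurableD _ (g_sigma_algebraType _)); first exact: hF.
  apply: (@bigsetU_measurable _ (g_sigma_algebraType _)) => k _.
  by apply: hF; exact: ltnW.
have mA m : measurable (A m) by exact: (measurable_history hX (hA m)).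
have hit m : (P (\bigcup_j exit X (A m) m D E j) <= e%:E * P (A m))%E.
  have mex j : measurable (exit X (A m) m D E j) by exact: (measurable_exit hX).
  apply: (@le_trans _ _ (\sum_(j <oo) P (exit X (A m) m D E j))%E).
    by apply: measure_sigma_subadditive => //; exact: bigcupT_measurable.
  have -> : e = e * c / c by rewrite mulfK// gt_eqF.
  apply: (exit_le hX (hA m) mD mE DE mf f0 c0) => //.
  - move=> w [Fw _]; apply: fL; apply: le_trans Fw.
    by rewrite /L le_max lexx.
  - by move=> x Sx Dx; apply: f_super => //; exact: le_lt_trans Dx.
have mU m : measurable (\bigcup_j exit X (A m) m D E j).
  by apply: bigcupT_measurable => j; exact: (measurable_exit hX).
have sub : returns r `<=`
    confined 0 L `|` \bigcup_m \bigcup_j exit X (A m) m D E j.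
  move=> w rw; have [cw|/unconfined_exists[k _ Lk]] := pselect (confined 0 L w).
    by left.
  right; have : (\bigcup_m F m) w by exists k => //; exact: ltW.
  rewrite seqDU_bigcup_eq => -[m _ Am]; exists m => //.
  have Dm : D (X m w).
    have [+ _] := Am; apply: lt_le_trans.
    by rewrite /L lt_max ltrDl ltr01 orbT.
  have [|j sj nD] := exit_exists Am Dm.
    have [i mi ir] := rw m; exists i => //.
    by rewrite /D /= => /(le_lt_trans ir); rewrite ltxx.
  exists j => //; split=> //.
  by rewrite /E /= leNgt; exact/negP.
apply: (@le_trans _ _ (P (confined 0 L) +
    P (\bigcup_m \bigcup_j exit X (A m) m D E j))%E).
  apply: le_trans (measureU2 _ _ _); last 2 first.
  - exact: measurable_confined.
  - exact: bigcupT_measurable.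
  apply: le_measure sub; rewrite inE //.
  by apply: measurableU; [exact: measurable_confined|exact: bigcupT_measurable].
rewrite nonconfined add0e.
apply: (@le_trans _ _ (\sum_(m <oo) (e%:E * P (A m)))%E).
  apply: (@le_trans _ _ (\sum_(m <oo) P (\bigcup_j exit X (A m) m D E j))%E).
    by apply: measure_sigma_subadditive => //; exact: bigcupT_measurable.
  exact: lee_nneseries.
rewrite nneseriesZl//.
have -> : (\sum_(m <oo) P (A m) = P (\bigcup_m A m))%E.
  rewrite measure_bigcup//; last exact: trivIset_seqDU.
  by apply: eq_eseriesl => i; rewrite in_setT.
rewrite -[leRHS]mule1 lee_wpmul2l ?lee_fin ?(ltW e0)//.
by apply: probability_le1; exact: bigcupT_measurable.
Qed.

Lemma lyapunov_transient : transient P X.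
Proof.
have P0 (n : nat) : P (returns (`|r0| + n%:R)) = 0%E.
  apply/eqP; rewrite -measure_le0; apply/lee_addgt0Pr => e e0.
  rewrite add0e; apply: returns_small => //.
  by rewrite (le_trans (ler_norm _))// lerDl.
have H : {ae P, forall w, forall n : nat, ~ returns (`|r0| + n%:R) w}.
  apply: ae_foralln => n; exists (returns (`|r0| + n%:R)).
  split=> [//||w /= /contrapT //]; exact: P0.
apply: filterS H.
move=> w h; apply/cvgryPgt => a.
have /= := h (Num.trunc `|a|).+1.
rewrite /returns/= => /existsNP[m hm]; exists m => // k /= mk.
rewrite ltNge; apply/negP => ka; apply: hm; exists k => //.
apply: (le_trans ka); rewrite (le_trans (ler_norm _))//.
by rewrite (le_trans (ltW (truncnS_gt _)))// lerDr.
Qed.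

End transience.

Section recurrence.
Variables (f : borel_cV R d -> R) (r0 : R).
Hypothesis mf : measurable_fun setT f.
Hypothesis f0 : forall x, 0 <= f x.
Hypothesis f_bounded : forall r : R, exists b : R,
  forall x : borel_cV R d, enorm (x : 'cV[R]_d) <= r -> f x <= b.
Hypothesis f_proper : forall M : R, exists L : R,
  forall x : borel_cV R d, L <= enorm (x : 'cV[R]_d) -> M <= f x.
Hypothesis f_super : forall x, S x -> r0 < enorm x ->
  (\int[K x]_z (f z)%:E <= (f x)%:E)%E.

Let escapes m r := [set w | enorm (X m w) <= r /\
  forall k, (m <= k)%N -> r0 < enorm (X k w)].

Let measurable_escapes m r : measurable (escapes m r).
Proof.
have -> : escapes m r =
    X m @^-1` [set x : borel_cV R d | enorm (x : 'cV[R]_d) <= r] `&`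
    \bigcap_k (X (k + m)%N @^-1`
      [set x : borel_cV R d | r0 < enorm (x : 'cV[R]_d)]).
  apply/seteqP; split=> w /= [h1 h2]; split=> // k.
    by move=> _; apply: h2; rewrite leq_addl.
  by move=> mk; have := h2 (k - m)%N I; rewrite /= subnK.
apply: measurableI.
  by apply: (measurable_state hX); exact: measurable_enorm_le.
apply: bigcapT_measurable => k.
by apply: (measurable_state hX); exact: measurable_enorm_gt.
Qed.

(** A path that avoids the ball of radius [r0] and is not confined must cross every distance L; as
    [f] is at most b at time m and at least c beyond L, this has probability at most b / c. *)
Let escapes0 m r : P (escapes m r) = 0%E.
Proof.
apply/eqP; rewrite -measure_le0; apply/lee_addgt0Pr => e e0; rewrite add0e.
have [b fb] := f_bounded r.
(* c >= b / e makes b / c <= e; the 1 keeps c positive whatever the sign of b. *)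
pose c := Num.max 1 (b / e).
have c0 : 0 < c by rewrite lt_max ltr01.
have [L0 fL] := f_proper c.
pose L := Num.max L0 (r + 1).
pose D := [set x : borel_cV R d | r0 < enorm (x : 'cV[R]_d)] `&`
  ~` [set x : borel_cV R d | L <= enorm (x : 'cV[R]_d)].
pose E := [set x : borel_cV R d | L <= enorm (x : 'cV[R]_d)].
have mE : measurable E by exact: measurable_enorm_ge.
have mD : measurable D.
  by apply: measurableI; [exact: measurable_enorm_gt|exact: measurableC].
have DE : D `&` E = set0.
  by apply/seteqP; split=> // x [[_]].
pose A := X m @^-1` [set x : borel_cV R d | enorm (x : 'cV[R]_d) <= r].
have hA : history X m A.
  by apply: history_preimage => //; exact: measurable_enorm_le.
have mA := measurable_history hX hA.
have mex j : measurable (exit X A m D E j) by exact: (measurable_exit hX).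
have mU := bigcupT_measurable _ mex.
have hit : (P (\bigcup_j exit X A m D E j) <= e%:E)%E.
  apply: (@le_trans _ _ (\sum_(j <oo) P (exit X A m D E j))%E).
    exact: measure_sigma_subadditive.
  apply: (@le_trans _ _ ((b / c)%:E * P A)%E).
    apply: (exit_le hX hA mD mE DE mf f0 c0) => //.
    - by move=> w; exact: fb.
    - by move=> z Ez; apply: fL; apply: le_trans Ez; rewrite /L le_max lexx.
    - by move=> x Sx [Dx _]; exact: f_super.
  apply: (@le_trans _ _ (e%:E * P A)%E).
    rewrite lee_wpmul2r// lee_fin ler_pdivrMr// mulrC -ler_pdivrMr//.
    by rewrite le_max lexx orbT.
  rewrite -[leRHS]mule1 lee_wpmul2l ?lee_fin ?(ltW e0)//.
  exact: probability_le1.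
have sub : escapes m r `<=` confined m L `|` \bigcup_j exit X A m D E j.
  move=> w [Aw ew].
  have [cw|/unconfined_exists[k mk Lk]] := pselect (confined m L w).
    by left.
  right; have Dm : D (X m w).
    split=> [|/= LX]; first exact: ew.
    have := le_trans LX Aw.
    by rewrite /L ge_max => /andP[_]; rewrite gerDl ler10.
  have [|j sj nD] := @exit_exists _ _ _ _ X A m D w Aw Dm.
    exists k => // -[_]; apply; exact: ltW.
  exists j => //; split=> //; apply: contrapT => nE; apply: nD; split=> //.
  by apply: ew; rewrite -addSn leq_addl.
apply: (@le_trans _ _ (P (confined m L) + P (\bigcup_j exit X A m D E j))%E).
  apply: le_trans (measureU2 _ _ _) => //; last exact: measurable_confined.
  apply: le_measure sub; rewrite inE //.
  by apply: measurableU => //; exact: measurable_confined.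
by rewrite nonconfined add0e.
Qed.

Lemma lyapunov_recurrent : recurrent P X.
Proof.
exists `|r0| => //.
have H n : {ae P, forall w, forall r : nat, ~ escapes n r%:R w}.
  apply: ae_foralln => r; exists (escapes n r%:R).
  split=> [//||w /= /contrapT //]; exact: escapes0.
apply: filterS (ae_foralln H) => w {}H.
rewrite limn_einf_lim; apply: lime_le; first exact: is_cvg_einfs.
apply: nearW => n.
(* The state at time n lies in some ball of integer radius, so countably many null events cover all
   cases: every tail of the path meets the ball of radius [r0]. *)
have := H n (Num.trunc (enorm (X n w))).+1.
rewrite /escapes /= => h.
have [k nk rk] : exists2 k, (n <= k)%N & enorm (X k w) <= r0.
  apply: contrapT => h'; apply: h; split; first exact/ltW/truncnS_gt.
  move=> k nk; rewrite ltNge; apply/negP => rk; apply: h'; by exists k.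
rewrite /einfs /=; apply: (@le_trans _ _ (enorm (X k w))%:E).
  by apply: ereal_inf_lbound; exists k.
by rewrite lee_fin (le_trans rk)// ler_norm.
Qed.

End recurrence.
End criteria.

Lemma measurable_jsq {R : realType} {d : nat} :
  measurable_fun setT (fun y : borel_cV R d => jsq (y : 'cV[R]_d)).
Proof.
apply: measurable_funD => //; apply: measurable_funX.
by apply: measurable_enorm => i; exact: measurable_coord.
Qed.

(** * One-step drift of the Lyapunov functions *)

Section drift_estimates.
Context {R : realType} {d : nat}.
Context (S : set 'cV[R]_d) (K : R.-pker (borel_cV R d) ~> (borel_cV R d)).
Implicit Types (x : 'cV[R]_d).
Variables (p B : R).
Hypothesis p23 : 2 < p <= 3.
Hypothesis moment : forall x, S x ->
  (E_incr K x (fun D => (enorm D `^ p)%R) <= B%:E)%E.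
Hypothesis zero_drift : forall x, S x -> drift K x = 0.

Lemma measurable_increment x (i : 'I_d) :
  measurable_fun setT (fun y : borel_cV R d => ((y : 'cV[R]_d) - x) i 0).
Proof.
have -> : (fun y : borel_cV R d => ((y : 'cV[R]_d) - x) i 0) =
    (fun y : borel_cV R d => (y : 'cV[R]_d) i 0 - x i 0).
  by apply/funext => y; rewrite !mxE.
by apply: measurable_funB => //; exact: measurable_coord.
Qed.

Let p2 : 2 <= p. Proof. by case/andP: p23 => /ltW. Qed.

Let incr_covE x i j :
  incr_cov K x i j = (\int[K x]_y
    ((((y : 'cV[R]_d) - x) i 0) * (((y : 'cV[R]_d) - x) j 0)))%R.
Proof.
rewrite mxE /E_incr /Rintegral; congr fine; apply: eq_integral => y _.
by rewrite mxE big_ord1 !mxE.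
Qed.

(** The coefficient [b] is absent from the bound because the drift vanishes. *)
Lemma kernel_quadratic_le x (f : borel_cV R d -> R) (a b c e g : R) : S x ->
  measurable_fun setT f -> (forall y, 0 <= f y) -> 0 <= g ->
  (forall D : 'cV[R]_d, f (x + D) <= a + b * dotp x D + c * enorm D ^+ 2 +
      e * dotp x D ^+ 2 + g * enorm D `^ p) ->
  (\int[K x]_y (f y)%:E <= (a + c * \tr (incr_cov K x) +
    e * (x^T *m incr_cov K x *m x) 0 0 + g * B)%:E)%E.
Proof.
move=> Sx mf f0 g0 fle.
have h := @integral_quadratic_le R d _ _ (K x) (@prob_kernel _ _ _ _ _ K x)
  (fun y : borel_cV R d => (y : 'cV[R]_d) - x) (measurable_increment x) p B p2
  (moment Sx) f x (drift K x) (incr_cov K x) a b c e g.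
apply: le_trans (h _ _ mf f0 g0 _) _.
- by move=> i; rewrite mxE.
- exact: incr_covE.
- by move=> y; have := fle ((y : 'cV[R]_d) - x); rewrite subrKC.
- rewrite zero_drift// /dotp big1 ?mulr0 ?addr0// => i _.
  by rewrite mxE mulr0.
Qed.

(** The moment bound makes the second moment finite, so the [fine] in [incr_cov] loses nothing and
    the trace is the true second moment of the increment. *)
Lemma trace_incr_cov_ge x (v : R) : S x ->
  (v%:E <= E_incr K x (fun D => (enorm D ^+ 2)%R))%E -> v <= \tr (incr_cov K x).
Proof.
move=> Sx.
have := @has_mean_quadratic R d _ _ (K x) (@prob_kernel _ _ _ _ _ K x)
  (fun y : borel_cV R d => (y : 'cV[R]_d) - x) (measurable_increment x) p B p2
  (moment Sx) 0 (drift K x) (incr_cov K x) 0 0 1 0.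
case; [by move=> i; rewrite mxE|exact: incr_covE|move=> ih].
rewrite !mul0r !add0r addr0 mul1r => <-; rewrite -lee_fin /Rintegral fineK.
  move=> /le_trans; apply; rewrite le_eqVlt; apply/orP; left; apply/eqP.
  apply: eq_integral => y _.
  by rewrite !mul0r !add0r addr0 mul1r.
exact: (integrable_fin_num _ ih).
Qed.

Lemma powR_neg_small (C h e : R) : 0 <= C -> 0 < h -> 0 < e ->
  exists2 s0 : R, 1 <= s0 & forall s, s0 <= s -> C * s `^ (- h) <= e.
Proof.
move=> C0 h0 e0; have Ce0 : 0 <= C / e by rewrite divr_ge0// ltW.
exists (Num.max 1 ((C / e) `^ h^-1)) => [|s]; first by rewrite le_max lexx.
rewrite ge_max => /andP[s1 sC].
have s0 : 0 < s by exact: lt_le_trans s1.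
rewrite powRN ler_pdivrMr ?powR_gt0// mulrC -ler_pdivrMr//.
have -> : C / e = ((C / e) `^ h^-1) `^ h.
  by rewrite -powRrM mulVf ?gt_eqF// powRr1.
by rewrite ge0_ler_powR ?nnegrE ?powR_ge0 ?(ltW s0) ?(ltW h0).
Qed.

Lemma powRN_le1 (s a : R) : 1 <= s -> 0 <= a -> s `^ (- a) <= 1.
Proof.
move=> s1 a0; rewrite powRN invf_le1 ?powR_gt0 ?(lt_le_trans _ s1)//.
by rewrite -(powRr0 s) ler_powR.
Qed.

Let B0 x : S x -> 0 <= B.
Proof.
move=> /moment; rewrite -lee_fin; apply: le_trans.
by apply: integral_ge0 => y _; rewrite lee_fin powR_ge0.
Qed.

Section nonconfinement.
Variable v : R.
Hypothesis v0 : 0 < v.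
Hypothesis nondegenerate : forall x, S x ->
  (v%:E <= E_incr K x (fun D => (enorm D ^+ 2)%R))%E.

(* A bounded function that gains [v / 2] per step inside the ball of radius [r]:
   the loss from truncation is of order [L^(2 - p)]. *)
Lemma truncated_square_drift r : exists L : R, forall x, S x -> enorm x <= r ->
  (\int[K x]_y (Num.max (L ^+ 2 - enorm (y : 'cV[R]_d) ^+ 2) 0)%:E + (v / 2)%:E
    <= (Num.max (L ^+ 2 - enorm x ^+ 2) 0)%:E)%E.
Proof.
have p2' : 0 < p - 2 by case/andP: p23; rewrite subr_gt0.
have [s0 s01 hs0] := @powR_neg_small (4 * `|B|) (p - 2) (v / 2)
  (mulr_ge0 (ler0n _ _) (normr_ge0 _)) p2' (divr_gt0 v0 (ltr0Sn _ _)).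
(* With |x| <= r <= h and L = 2 h, only jumps of length at least h can leave the ball of radius L;
   [s0] makes the truncation error g B at most v / 2. *)
pose h := Num.max s0 (Num.max 1 r); pose L := 2 * h.
have hge : [/\ s0 <= h, 1 <= h & r <= h] by rewrite /h !le_max !lexx !orbT.
case: hge => s0h h1 rh.
exists L => x Sx xr.
have BB : B = `|B| by rewrite ger0_norm// (B0 Sx).
have x2 : enorm x ^+ 2 <= L ^+ 2.
  by rewrite lerXn2r ?nnegrE ?enorm_ge0// /L; lra.
pose g := 4 * h `^ (- (p - 2)).
have g0 : 0 <= g by rewrite mulr_ge0// powR_ge0.
pose f (y : borel_cV R d) := Num.max (L ^+ 2 - enorm (y : 'cV[R]_d) ^+ 2) 0.
have mf : measurable_fun setT f.
  apply: measurable_maxr => //; apply: measurable_funB => //.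
  apply: measurable_funX; apply: measurable_enorm => i.
  exact: measurable_coord.
have f0 y : 0 <= f y by rewrite /f le_max lexx orbT.
have key (D : 'cV[R]_d) : f (x + D) <= L ^+ 2 - enorm x ^+ 2 +
    (-2) * dotp x D + (-1) * enorm D ^+ 2 + 0 * dotp x D ^+ 2 +
    g * enorm D `^ p.
  have E : L ^+ 2 - enorm x ^+ 2 + (-2) * dotp x D + (-1) * enorm D ^+ 2 +
    0 * dotp x D ^+ 2 = L ^+ 2 - enorm (x + D) ^+ 2.
    by rewrite sqr_enormD; ring.
  rewrite E /f ge_max; have gD : 0 <= g * enorm D `^ p.
    by rewrite mulr_ge0// powR_ge0.
  rewrite lerDl gD /=.
  have [yL|Ly] := leP (enorm (x + D)) L.
    rewrite addr_ge0// subr_ge0 lerXn2r ?nnegrE ?enorm_ge0//.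
    by rewrite /L; lra.
  (* Hence |x + D| <= 2 |D|, and |x + D|^2 <= 4 |D|^2 <= 4 h^(2 - p) |D|^p, which is the origin of
     [g]. *)
  have Dh : h <= enorm D.
    by have := enormD_le x D; rewrite /L in Ly *; lra.
  have yD : enorm (x + D) <= 2 * enorm D.
    by have := enormD_le x D; lra.
  suff : enorm (x + D) ^+ 2 <= g * enorm D `^ p.
    by have := sqr_ge0 L; lra.
  apply: (@le_trans _ _ (4 * enorm D ^+ 2)).
    have -> : 4 * enorm D ^+ 2 = (2 * enorm D) ^+ 2 by ring.
    by rewrite lerXn2r ?nnegrE ?mulr_ge0 ?enorm_ge0.
  rewrite /g -mulrA ler_wpM2l//.
  have h0 : 0 < h by lra.
  have D0 : 0 < enorm D by exact: lt_le_trans Dh.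
  have -> : enorm D `^ p = enorm D `^ (p - 2) * enorm D ^+ 2.
    rewrite -powR_mulrn ?enorm_ge0// -powRD ?subrK//.
    by rewrite (gt_eqF D0) implybT.
  rewrite mulrA ler_peMl ?sqr_ge0// powRN mulrC ler_pdivlMr ?powR_gt0// mul1r.
  by rewrite ge0_ler_powR ?nnegrE ?(ltW h0) ?(ltW D0) ?(ltW p2').
have := kernel_quadratic_le Sx mf f0 g0 key.
have T := trace_incr_cov_ge Sx (nondegenerate Sx).
move=> /(leeD2r (v / 2)%:E) /le_trans; apply.
rewrite -EFinD lee_fin mul0r addr0 [leRHS]max_l ?subr_ge0//.
have gB : g * B <= v / 2.
  by have := hs0 _ s0h; rewrite /g -BB; lra.
by lra.
Qed.
End nonconfinement.

Local Notation T x := (\tr (incr_cov K x)).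
Local Notation Q x := ((x^T *m incr_cov K x *m x) 0 0).

(** The remainder is s^(-p/2) without a factor s^(-a), so it is negligible against the main term
    s^(-1-a) only when a < p/2 - 1. *)
Lemma powR_drift_le (a : R) : 0 < a -> exists2 C : R, 0 <= C & forall x, S x ->
  (\int[K x]_y ((1 + enorm (y : 'cV[R]_d) ^+ 2) `^ (- a))%:E <=
   (jsq x `^ (- a) *
       (1 - a * (T x / jsq x) + 2 * a * (a + 1) * (Q x / jsq x ^+ 2))
     + C * jsq x `^ (- (p / 2)))%:E)%E.
Proof.
move=> a0; have [C C0 HC] := powR_increment_le p23 a0.
(* The constant is chosen before a point of [S] is at hand, and 0 <= B is only known at such a
   point; hence the absolute value. *)
exists (C * `|B|) => [|x Sx]; first by rewrite mulr_ge0.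
have BB : `|B| = B by rewrite ger0_norm// (B0 Sx).
set k := jsq x `^ (- a).
have k01 : 0 <= k <= 1.
  by rewrite powR_ge0 /= powRN_le1 ?jsq_ge1 ?(ltW a0).
have := @kernel_quadratic_le x
  (fun y : borel_cV R d => (1 + enorm (y : 'cV[R]_d) ^+ 2) `^ (- a))
  k (- (2 * k * a / jsq x)) (- (k * a / jsq x))
  (k * (2 * a * (a + 1)) / jsq x ^+ 2) (C * jsq x `^ (- (p / 2))) Sx.
move=> h; apply: le_trans (h _ _ _ _) _.
- exact: measurableT_comp (measurable_powR _) measurable_jsq.
- by move=> y; exact: powR_ge0.
- by rewrite mulr_ge0 ?powR_ge0.
- move=> D; have z0 := one_increment_gt0 x D.
  rewrite -/(jsq (x + D)) jsq_increment powRM ?(ltW z0) ?(ltW (jsq_gt0 x))//.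
  have kz : k * (1 + (2 * rel_dot x D + rel_norm x D ^+ 2)) `^ (- a) <= 1.
    rewrite /k -powRM ?(ltW z0) ?(ltW (jsq_gt0 x))// -jsq_increment.
    by rewrite powRN_le1 ?jsq_ge1 ?(ltW a0).
  apply: le_trans (HC k _ _ k01 (rel_dot_le x D) z0 kz) _.
  rewrite rel_norm_powR rel_normE /rel_dot exprMn exprVn.
  rewrite le_eqVlt; apply/orP; left; apply/eqP.
  by field; exact: lt0r_neq0 (jsq_gt0 x).
- rewrite lee_fin BB le_eqVlt; apply/orP; left; apply/eqP.
  by field; exact: lt0r_neq0 (jsq_gt0 x).
Qed.

Lemma ln_powR_drift_le (a : R) : 0 < a ->
  exists2 C : R, 0 <= C & forall x, S x ->
  (\int[K x]_y (ln (1 + enorm (y : 'cV[R]_d) ^+ 2) + 1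
       - (1 + enorm (y : 'cV[R]_d) ^+ 2) `^ (- a))%:E <=
   (ln (jsq x) + 1 - jsq x `^ (- a) + (1 + a * jsq x `^ (- a)) * (T x / jsq x)
     - (2 + 2 * a * (a + 1) * jsq x `^ (- a)) * (Q x / jsq x ^+ 2)
     + C * jsq x `^ (- (p / 2)))%:E)%E.
Proof.
move=> a0; have [C C0 HC] := powR_increment_ge p23 a0.
have [C' C'0 HC'] := ln_increment_le p23.
exists ((C + C') * `|B|) => [|x Sx]; first by rewrite mulr_ge0// addr_ge0.
have BB : `|B| = B by rewrite ger0_norm// (B0 Sx).
set k := jsq x `^ (- a).
have k0 : 0 <= k by exact: powR_ge0.
have k1 : k <= 1 by rewrite powRN_le1 ?jsq_ge1 ?(ltW a0).
have := @kernel_quadratic_le x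
  (fun y : borel_cV R d => ln (1 + enorm (y : 'cV[R]_d) ^+ 2) + 1
    - (1 + enorm (y : 'cV[R]_d) ^+ 2) `^ (- a))
  (ln (jsq x) + 1 - k) (2 * (1 + k * a) / jsq x) ((1 + k * a) / jsq x)
  (- (2 + k * (2 * a * (a + 1))) / jsq x ^+ 2)
  ((C + C') * jsq x `^ (- (p / 2))) Sx.
move=> h; apply: le_trans (h _ _ _ _) _.
- apply: measurable_funB; last first.
    exact: measurableT_comp (measurable_powR _) measurable_jsq.
  apply: measurable_funD => //.
  exact: measurableT_comp (@measurable_ln R) measurable_jsq.
- move=> y; rewrite -addrA addr_ge0 ?ln_ge0 ?jsq_ge1// subr_ge0.
  by rewrite powRN_le1 ?jsq_ge1 ?(ltW a0).
- by rewrite mulr_ge0 ?powR_ge0 ?addr_ge0.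
- move=> D; have z0 := one_increment_gt0 x D.
  rewrite -/(jsq (x + D)) jsq_increment lnM ?posrE ?jsq_gt0//.
  rewrite powRM ?(ltW z0) ?(ltW (jsq_gt0 x))// -/k.
  have h1 := HC' _ _ (rel_dot_le x D) z0.
  have h2 := ler_wpM2l k0 (HC _ _ (rel_dot_le x D) z0).
  (* Adding this nonnegative term turns the remainder (k C + C') r^p into (C + C') r^p, whose
     constant is uniform in x. *)
  have rp0 : 0 <= (1 - k) * (C * rel_norm x D `^ p).
    by rewrite mulr_ge0 ?subr_ge0// mulr_ge0// powR_ge0.
  apply: (@le_trans _ _ (ln (jsq x) + (2 * rel_dot x D + rel_norm x D ^+ 2 -
    2 * rel_dot x D ^+ 2 + C' * rel_norm x D `^ p) + 1 -
    k * (1 - a * (2 * rel_dot x D + rel_norm x D ^+ 2) +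
    2 * a * (a + 1) * rel_dot x D ^+ 2 - C * rel_norm x D `^ p) +
    (1 - k) * (C * rel_norm x D `^ p))).
    by lra.
  rewrite rel_norm_powR rel_normE /rel_dot exprMn exprVn.
  rewrite le_eqVlt; apply/orP; left; apply/eqP.
  by field; exact: lt0r_neq0 (jsq_gt0 x).
- rewrite lee_fin BB le_eqVlt; apply/orP; left; apply/eqP.
  by field; exact: lt0r_neq0 (jsq_gt0 x).
Qed.

End drift_estimates.

(** * Supermartingales far from the origin *)

Section asymptotic_covariance.
Context {R : realType} {d : nat}.
Context (S : set 'cV[R]_d) (K : R.-pker (borel_cV R d) ~> (borel_cV R d)).
Variables (p B : R).
Hypothesis p23 : 2 < p <= 3.
Hypothesis moment : forall x, S x ->
  (E_incr K x (fun D => (enorm D `^ p)%R) <= B%:E)%E.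
Hypothesis zero_drift : forall x, S x -> drift K x = 0.
Variables (sigma2 : 'cV[R]_d -> 'M[R]_d) (U V : R).
Hypothesis U_gt0 : 0 < U.
Hypothesis sigma2_radial :
  forall u, sphere u -> (u^T *m sigma2 u *m u) 0 0 = U.
Hypothesis sigma2_trace : forall u, sphere u -> \tr (sigma2 u) = V.
Implicit Types (x : 'cV[R]_d).

Definition cov_dev x : R := opnorm (incr_cov K x - sigma2 (hat x)).

Local Notation T x := (\tr (incr_cov K x)).
Local Notation Q x := ((x^T *m incr_cov K x *m x) 0 0).

Lemma cov_dev_ge0 x : x != 0 -> 0 <= cov_dev x.
Proof.
by move=> x0; rewrite (le_trans _ (quad_opnorm _ (sphere_hat x0))).
Qed.

Lemma trace_incr_cov_dev x : x != 0 -> `|T x - V| <= d%:R * cov_dev x.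
Proof.
move=> x0; rewrite -(sigma2_trace (sphere_hat x0)) -raddfB.
exact: trace_opnorm.
Qed.

Lemma quad_incr_cov_dev x : x != 0 ->
  `|Q x - U * enorm x ^+ 2| <= cov_dev x * enorm x ^+ 2.
Proof.
move=> x0; have sx := sphere_hat x0; rewrite quad_hat//.
rewrite -(sigma2_radial sx) mulrC -mulrBl normrM.
rewrite [X in _ * X]ger0_norm ?sqr_ge0//.
rewrite ler_wpM2r ?sqr_ge0//; apply: le_trans (quad_opnorm _ sx).
by rewrite mulmxBr mulmxBl [X in _ <= `|X|]mxE [X in _ <= `|_ + X|]mxE.
Qed.

Lemma powR_supermartingale : 2 * U < V ->
  (forall e, 0 < e ->
     exists r, forall x, S x -> r < enorm x -> cov_dev x <= e) ->
  exists2 a : R, 0 < a & exists r0 : R, forall x, S x -> r0 < enorm x ->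
    (\int[K x]_y (jsq (y : 'cV[R]_d) `^ (- a))%:E <= (jsq x `^ (- a))%:E)%E.
Proof.
move=> UV dev0; pose g := V - 2 * U.
have g0 : 0 < g by rewrite subr_gt0.
have p2 : 0 < p - 2 by case/andP: p23; rewrite subr_gt0.
(* The first bound makes 2 a^2 U <= a g / 4; the second keeps p/2 - 1 - a positive. *)
pose a := Num.min (g / (8 * U)) ((p - 2) / 4).
have a0 : 0 < a by rewrite lt_min !divr_gt0// mulr_gt0.
have aU : 8 * U * a <= g.
  by rewrite mulrC -ler_pdivlMr ?mulr_gt0// ge_min lexx.
have ap : a <= (p - 2) / 4 by rewrite ge_min lexx orbT.
exists a => //.
have [C C0 HC] := powR_drift_le p23 moment zero_drift a0.
have h0 : 0 < p / 2 - 1 - a by lra.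
have ag0 : 0 < a * g / 4 by rewrite divr_gt0// mulr_gt0.
have [s0 s01 hs0] := powR_neg_small C0 h0 ag0.
(* The covariance deviation e enters the drift as a (d + 2 (a + 1)) e = a c e / 4. With c e <= g,
   three errors of at most a g / 4 stand against the main term - a g. *)
pose c := 4 * (d%:R + 2 * (a + 1)).
have c0 : 0 < c.
  by rewrite mulr_gt0// ltr_wpDl// mulr_gt0// addr_gt0.
have [r1 hr1] := dev0 (g / c) (divr_gt0 g0 c0).
exists (Num.max r1 s0) => x Sx; rewrite gt_max => /andP[xr1 xs0].
have xn0 : x != 0.
  by apply: contraTneq xs0 => ->; rewrite enorm0 -leNgt; lra.
have e0 := cov_dev_ge0 xn0.
have eg := hr1 x Sx xr1.
set e := cov_dev x in e0 eg.
have sge := le_trans (ltW xs0) (enorm_le_jsq x).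
have sgt0 := jsq_gt0 x.
apply: le_trans (HC x Sx) _; rewrite lee_fin.
set k := jsq x `^ (- a); have k0 : 0 < k by exact: powR_gt0.
have -> : jsq x `^ (- (p / 2)) = k / jsq x * jsq x `^ (- (p / 2 - 1 - a)).
  rewrite /k -(powR_inv1 (ltW sgt0)) -!powRD ?(gt_eqF sgt0) ?implybT//.
  by congr (_ `^ _); field.
set y := jsq x `^ (- (p / 2 - 1 - a)).
have Cy : C * y <= a * g / 4 by exact: hs0.
have HT : V - d%:R * e <= T x.
  have := trace_incr_cov_dev xn0; rewrite ler_norml => /andP[+ _].
  by rewrite -/e; lra.
have HQ : Q x / jsq x <= U + e.
  rewrite ler_pdivrMr//.
  have := quad_incr_cov_dev xn0; rewrite ler_norml => /andP[_].
  rewrite -/e /jsq; have := U_gt0; rewrite mulrDr mulr1 mulrDl.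
  move: e0; move: (Q x) (enorm x ^+ 2) => q n2; lra.
have ec : c * e <= g by rewrite mulrC -ler_pdivlMr.
have key : - a * T x + 2 * a * (a + 1) * (Q x / jsq x) + C * y <= 0.
  have h1 := ler_wpM2l (ltW a0) HT.
  have a2 : 0 <= 2 * a * (a + 1) by rewrite !mulr_ge0// ltW// addr_gt0.
  have h2 := ler_wpM2l a2 HQ.
  have h3 := ler_wpM2l (ltW a0) ec.
  have h4 := ler_wpM2l (ltW a0) aU.
  rewrite /c in h3.
  apply: (@le_trans _ _ (- (a * (V - d%:R * e)) + 2 * a * (a + 1) * (U + e) +
    a * g / 4)); first lra.
  have -> : - (a * (V - d%:R * e)) + 2 * a * (a + 1) * (U + e) + a * g / 4 =
    - (a * g) + a * (8 * U * a) / 4 + a * (4 * (d%:R + 2 * (a + 1)) * e) / 4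
    + a * g / 4.
    by rewrite /g; field.
  have : 0 < a * g by rewrite mulr_gt0.
  lra.
have -> : k * (1 - a * (T x / jsq x) + 2 * a * (a + 1) * (Q x / jsq x ^+ 2)) +
    C * (k / jsq x * y) =
    k + k / jsq x *
      (- a * T x + 2 * a * (a + 1) * (Q x / jsq x) + C * y).
  by field; exact: lt0r_neq0.
by rewrite gerDl mulr_ge0_le0// ltW// divr_gt0.
Qed.

(* In the critical case the drift of [ln] is only [O(s^(-1-h))] with unknown
   sign; the correction [- s^(-a)] with [a < h] contributes a drift of order
   [- s^(-1-a)] that dominates it. *)
Definition log_lyapunov (a : R) (y : borel_cV R d) : R :=
  ln (jsq (y : 'cV[R]_d)) + 1 - jsq (y : 'cV[R]_d) `^ (- a).

(** With k = s^(-a), putting T = V and Q = U into the drift gives V - 2 U + a k (V - 2 U) - 2 a^2 U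
    k, whose second term is nonpositive. The right-hand side of the hypothesis is thus the gain from
    the correction. The three errors come from the covariance, from |x|^2 = s - 1 in place of s, and
    from the Taylor remainder. *)
Lemma log_lyapunov_drift (a : R) : 0 < a -> V <= 2 * U ->
  exists2 C : R, 0 <= C & forall x, S x -> x != 0 ->
  V - 2 * U + C * (cov_dev x + jsq x `^ (-1) + jsq x `^ (- (p / 2 - 1)))
    <= 2 * a ^+ 2 * U * jsq x `^ (- a) ->
  (\int[K x]_y (log_lyapunov a y)%:E <= (log_lyapunov a x)%:E)%E.
Proof.
move=> a0 VU.
have [C C0 HC] := ln_powR_drift_le p23 moment zero_drift a0.
have aa0 : 0 <= 2 * a * (a + 1) by rewrite !mulr_ge0// ltW// addr_gt0.
have d0 : 0 <= d%:R :> R by exact: ler0n.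
have U0 := ltW U_gt0.
exists ((1 + a) * d%:R + (2 + 2 * a * (a + 1)) * (1 + U) + C) => [|x Sx xn0].
  by rewrite !addr_ge0// mulr_ge0// addr_ge0// ltW.
have e0 := cov_dev_ge0 xn0.
have sgt0 := jsq_gt0 x.
set k := jsq x `^ (- a).
have k0 : 0 <= k by exact: powR_ge0.
have k1 : k <= 1 by rewrite powRN_le1 ?jsq_ge1 ?(ltW a0).
rewrite powR_inv1 ?(ltW sgt0)//; set y := jsq x `^ (- (p / 2 - 1)).
have y0 : 0 <= y by exact: powR_ge0.
have i0 : 0 <= (jsq x)^-1 by rewrite invr_ge0 ltW.
set e := cov_dev x in e0 *; set i := (jsq x)^-1 in i0 *.
move=> hyp.
apply: le_trans (HC x Sx) _; rewrite lee_fin /log_lyapunov -/k.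
have -> : jsq x `^ (- (p / 2)) = i * y.
  rewrite /i /y -(powR_inv1 (ltW sgt0)) -!powRD ?(gt_eqF sgt0) ?implybT//.
  by congr (_ `^ _); field.
have HT : T x <= V + d%:R * e.
  have := trace_incr_cov_dev xn0; rewrite ler_norml => /andP[_].
  by rewrite -/e; lra.
set q := Q x * i.
have HQ : U - e - U * i <= q.
  have := quad_incr_cov_dev xn0; rewrite ler_norml => /andP[+ _]; rewrite -/e.
  have si : jsq x * i = 1 by rewrite mulfV// gt_eqF.
  have -> : enorm x ^+ 2 = jsq x - 1 by rewrite /jsq [1 + _]addrC addrK.
  move=> h; have h' : (U - e) * (jsq x - 1) <= Q x.
    by move: h; move: (Q x) (jsq x) => t s; lra.
  have := ler_wpM2r i0 h'.
  rewrite -/q -[_ * _ * i]mulrA [(_ - 1) * i]mulrBl si mul1r => h2.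
  have := mulr_ge0 e0 i0; lra.
have -> : Q x / jsq x ^+ 2 = i * q.
  by rewrite /q /i; field; exact: lt0r_neq0.
have key : (1 + a * k) * T x - (2 + 2 * a * (a + 1) * k) * q + C * y <= 0.
  have ak0 : 0 <= 1 + a * k by rewrite addr_ge0// mulr_ge0// ltW.
  have bk0 : 0 <= 2 + 2 * a * (a + 1) * k by rewrite addr_ge0// mulr_ge0.
  have h1 := ler_wpM2l ak0 HT.
  have h2 := ler_wpM2l bk0 HQ.
  apply: (@le_trans _ _ ((1 + a * k) * (V + d%:R * e) -
    (2 + 2 * a * (a + 1) * k) * (U - e - U * i) + C * y)); first lra.
  have -> : (1 + a * k) * (V + d%:R * e) -
      (2 + 2 * a * (a + 1) * k) * (U - e - U * i) + C * y =
    V - 2 * U + a * k * (V - 2 * U) - 2 * a ^+ 2 * U * k +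
    (1 + a * k) * (d%:R * e) + (2 + 2 * a * (a + 1) * k) * (e + U * i) + C * y.
    by ring.
  have t1 : a * k * (V - 2 * U) <= 0.
    by rewrite mulr_ge0_le0 ?subr_le0// mulr_ge0// ltW.
  have t2 : (1 + a * k) * (d%:R * e) <= (1 + a) * (d%:R * e).
    by rewrite ler_wpM2r ?mulr_ge0// lerD2l ler_piMr// ltW.
  have t3 : (2 + 2 * a * (a + 1) * k) * (e + U * i) <=
      (2 + 2 * a * (a + 1)) * (e + U * i).
    by rewrite ler_wpM2r ?addr_ge0 ?mulr_ge0// lerD2l ler_piMr.
  have t4 : (2 + 2 * a * (a + 1)) * (e + U * i) <=
      (2 + 2 * a * (a + 1)) * ((1 + U) * (e + i + y)).
    rewrite ler_wpM2l ?addr_ge0//.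
    have := mulr_ge0 U0 e0; have := mulr_ge0 U0 y0.
    rewrite mulrDl mul1r !mulrDr; lra.
  have t5 : (1 + a) * (d%:R * e) <= (1 + a) * d%:R * (e + i + y).
    rewrite -mulrA ler_wpM2l ?addr_ge0 ?(ltW a0)// ler_wpM2l//; lra.
  have t6 : C * y <= C * (e + i + y) by rewrite ler_wpM2l//; lra.
  move: hyp; rewrite [X in _ + X <= _]mulrDl [X in _ + (X + _) <= _]mulrDl.
  rewrite -[X in _ + (_ + X + _) <= _]mulrA.
  lra.
have -> : ln (jsq x) + 1 - k + (1 + a * k) * (T x * i) -
    (2 + 2 * a * (a + 1) * k) * (i * q) + C * (i * y) =
  ln (jsq x) + 1 - k +
    i * ((1 + a * k) * T x - (2 + 2 * a * (a + 1) * k) * q + C * y) by ring.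
by rewrite gerDl mulr_ge0_le0.
Qed.

(** The strict gap 2 U - V alone absorbs the three errors, a third each; the exponent 1 is an
    arbitrary choice. *)
Lemma log_supermartingale_noncritical : V < 2 * U ->
  (forall e, 0 < e ->
     exists r, forall x, S x -> r < enorm x -> cov_dev x <= e) ->
  exists r0 : R, forall x, S x -> r0 < enorm x ->
    (\int[K x]_y (log_lyapunov 1 y)%:E <= (log_lyapunov 1 x)%:E)%E.
Proof.
move=> VU dev0.
have [C C0 HC] := log_lyapunov_drift ltr01 (ltW VU).
pose g := 2 * U - V; have g0 : 0 < g by rewrite subr_gt0.
have g3 : 0 < g / 3 by rewrite divr_gt0.
have C1 : 0 < C + 1 by rewrite ltr_wpDl.
have p2 : 0 < p / 2 - 1 by case/andP: p23 => ? ?; lra.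
have [r1 hr1] := dev0 (g / 3 / (C + 1)) (divr_gt0 g3 C1).
have [s1 s11 hs1] := powR_neg_small C0 ltr01 g3.
have [s2 s21 hs2] := powR_neg_small C0 p2 g3.
exists (Num.max r1 (Num.max s1 s2)) => x Sx.
rewrite !gt_max => /and3P[xr1 xs1 xs2].
have xn0 : x != 0.
  by apply: contraTneq xs1 => ->; rewrite enorm0 -leNgt; lra.
have e0 := cov_dev_ge0 xn0.
have sge := enorm_le_jsq x.
apply: HC => //.
have h1 := hs1 _ (le_trans (ltW xs1) sge).
have h2 := hs2 _ (le_trans (ltW xs2) sge).
have h3 : C * cov_dev x <= g / 3.
  have := hr1 x Sx xr1; rewrite ler_pdivlMr//; lra.
apply: (@le_trans _ _ 0).
  by rewrite !mulrDr; rewrite /g in h1 h2 h3; lra.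
by rewrite !mulr_ge0 ?powR_ge0// ?sqr_ge0// ltW.
Qed.

Lemma log_supermartingale_critical : 2 * U = V ->
  (exists2 h : R, 0 < h & exists C r, forall x, S x -> r < enorm x ->
     cov_dev x <= C * enorm x `^ (- h)) ->
  exists2 a : R, 0 < a & exists r0 : R, forall x, S x -> r0 < enorm x ->
    (\int[K x]_y (log_lyapunov a y)%:E <= (log_lyapunov a x)%:E)%E.
Proof.
move=> UV [h h0 [c [r1 hr1]]].
have p2 : 0 < p / 2 - 1 by case/andP: p23 => ? ?; lra.
have h2 : 0 < h / 2 by rewrite divr_gt0.
(* The three errors decay in s with these exponents, the first because |x|^(-h) is of order
   s^(-h/2). Half the minimum is strictly below each of them. *)
pose m := Num.min (h / 2) (Num.min 1 (p / 2 - 1)).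
have m0 : 0 < m by rewrite !lt_min h2 ltr01.
have [mh m1 mp] : [/\ m <= h / 2, m <= 1 & m <= p / 2 - 1].
  by rewrite !ge_min !lexx !orbT.
pose a := m / 2; have a0 : 0 < a by rewrite divr_gt0.
exists a => //.
have VU : V <= 2 * U by rewrite UV.
have [C C0 HC] := log_lyapunov_drift a0 VU.
(* A third of the gain is allotted to each error. *)
pose b := 2 * a ^+ 2 * U / 3.
have b0 : 0 < b by rewrite divr_gt0// mulr_gt0// mulr_gt0// exprn_gt0.
have c0 : 0 <= C * (`|c| * 2 `^ (h / 2)) by rewrite !mulr_ge0// powR_ge0.
have ha : 0 < h / 2 - a by rewrite /a; lra.
have ia : 0 < 1 - a by rewrite /a; lra.
have pa : 0 < p / 2 - 1 - a by rewrite /a; lra.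
have [s0 s01 hs0] := powR_neg_small c0 ha b0.
have [s1 s11 hs1] := powR_neg_small C0 ia b0.
have [s2 s21 hs2] := powR_neg_small C0 pa b0.
exists (Num.max r1 (Num.max s0 (Num.max s1 s2))) => x Sx.
rewrite !gt_max => /and4P[xr1 xs0 xs1 xs2].
have n1 : 1 < enorm x by exact: le_lt_trans xs1.
have n0 : 0 < enorm x by exact: lt_trans n1.
have xn0 : x != 0 by apply: contraTneq n0 => ->; rewrite enorm0 ltxx.
have sge := enorm_le_jsq x.
have sgt0 := jsq_gt0 x.
have q0 := hs0 _ (le_trans (ltW xs0) sge).
have q1 := hs1 _ (le_trans (ltW xs1) sge).
have q2 := hs2 _ (le_trans (ltW xs2) sge).
have split_pow t : jsq x `^ (- t) = jsq x `^ (- (t - a)) * jsq x `^ (- a).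
  rewrite -powRD ?(gt_eqF sgt0) ?implybT//; congr (_ `^ _); ring.
have k0 : 0 <= jsq x `^ (- a) by exact: powR_ge0.
apply: HC => //.
have t0 : C * cov_dev x <= b * jsq x `^ (- a).
  apply: le_trans (ler_wpM2r k0 q0).
  rewrite -[leRHS]mulrA -split_pow -[leRHS]mulrA ler_wpM2l//.
  apply: le_trans (hr1 x Sx xr1) _.
  apply: (@le_trans _ _ (`|c| * enorm x `^ (- h))).
    by rewrite ler_wpM2r ?powR_ge0// ler_norm.
  rewrite -mulrA ler_wpM2l//.
  have -> : enorm x `^ (- h) = (enorm x ^+ 2) `^ (- (h / 2)).
    by rewrite -powR_mulrn ?(ltW n0)// -powRrM; congr (_ `^ _); field.
  (* Valid since |x| > 1; it converts decay in |x| into decay in s at the price of the factor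
     2^(h/2). *)
  have js : jsq x / 2 <= enorm x ^+ 2.
    by rewrite /jsq; set n := enorm x in n1 *; nra.
  have -> : 2 `^ (h / 2) * jsq x `^ (- (h / 2)) = (jsq x / 2) `^ (- (h / 2)).
    rewrite powRM ?(ltW sgt0)//.
    rewrite mulrC; congr (_ * _).
    by rewrite -powR_inv1// -powRrM; congr (_ `^ _); ring.
  rewrite !powRN lef_pV2 ?posrE ?powR_gt0 ?divr_gt0 ?exprn_gt0//.
  rewrite ge0_ler_powR ?nnegrE ?(ltW h2) ?sqr_ge0//.
  by rewrite divr_ge0// ltW.
have t1 : C * jsq x `^ (-1) <= b * jsq x `^ (- a).
  by apply: le_trans (ler_wpM2r k0 q1); rewrite -[leRHS]mulrA -split_pow.
have t2 : C * jsq x `^ (- (p / 2 - 1)) <= b * jsq x `^ (- a).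
  by apply: le_trans (ler_wpM2r k0 q2); rewrite -[leRHS]mulrA -split_pow.
rewrite UV subrr add0r !mulrDr.
have -> : 2 * a ^+ 2 * U * jsq x `^ (- a) = 3 * (b * jsq x `^ (- a)).
  by rewrite /b; field.
lra.
Qed.

End asymptotic_covariance.

(** * Nonconfinement and reduction of the moment exponent *)

Section state_space.
Context {R : realType} {d : nat} {disp : measure_display}.
Context {Omega : measurableType disp} (P : probability Omega R).
Context (S : set 'cV[R]_d) (K : R.-pker (borel_cV R d) ~> (borel_cV R d)).
Context (x0 : 'cV[R]_d) (X : nat -> Omega -> borel_cV R d).

Lemma confined_null (p B v : R) : markov_process P S K x0 X ->
  2 < p <= 3 ->
  (forall x, S x -> (E_incr K x (fun D => (enorm D `^ p)%R) <= B%:E)%E) ->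
  (forall x, S x -> drift K x = 0) -> 0 < v ->
  (forall x, S x -> (v%:E <= E_incr K x (fun D => (enorm D ^+ 2)%R))%E) ->
  forall m r, P (confined X m r) = 0%E.
Proof.
move=> hX p23 moment zd v0 nd m r.
have [L HL] := truncated_square_drift p23 moment zd v0 nd r.
pose D := [set x : borel_cV R d | enorm (x : 'cV[R]_d) <= r].
have -> : confined X m r = \bigcap_j stay X setT m D j.
  apply/seteqP; split=> w /= h.
    by move=> j _; apply/stayP; split=> // k _; apply: h; exact: leq_addl.
  move=> k mk; have /stayP[_ /(_ _ (leqnn _))] := h (k - m)%N I.
  by rewrite subnK.
pose f (y : borel_cV R d) := Num.max (L ^+ 2 - enorm (y : 'cV[R]_d) ^+ 2) 0.
apply: (stay_forever0 (b := L ^+ 2) hX m _ _ _ _ HL) => //.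
- exact: measurable_enorm_le.
- apply: measurable_maxr => //; apply: measurable_funB => //.
  apply: measurable_funX; apply: measurable_enorm => i.
  exact: measurable_coord.
- move=> z; rewrite le_max lexx orbT /= ge_max sqr_ge0 andbT.
  by rewrite gerBl sqr_ge0.
- by rewrite divr_gt0.
Qed.

(** The exponent is capped at 3 so that r^3 <= r^p for r <= 1, as the expansions require. Under a
    probability measure, q^(min p 3) <= 1 + q^p costs only an additive 1. *)
Lemma moment_le3 (p : R) : 2 < p ->
  (ereal_sup [set E_incr K x (fun D => (enorm D `^ p)%R) | x in S] < +oo)%E ->
  exists p' B : R, 2 < p' <= 3 /\
    forall x, S x -> (E_incr K x (fun D => (enorm D `^ p')%R) <= B%:E)%E.
Proof.
move=> p2 supoo; set M := ereal_sup _ in supoo.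
exists (Num.min p 3), (1 + fine M); split.
  by rewrite lt_min p2 ge_min lexx orbT /=; lra.
move=> x Sx.
have xM : (E_incr K x (fun D => (enorm D `^ p)%R) <= M)%E.
  by apply: ereal_sup_ubound; exists x.
have M0 : (0 <= M)%E.
  apply: le_trans xM; apply: integral_ge0 => y _.
  by rewrite lee_fin powR_ge0.
have Mfin : M \is a fin_num by rewrite ge0_fin_numE.
have mq q : measurable_fun setT
    (fun y : borel_cV R d => (enorm ((y : 'cV[R]_d) - x) `^ q)%:E).
  apply/measurable_EFinP; apply: (measurableT_comp (measurable_powR q)).
  by apply: measurable_enorm => i; exact: measurable_increment.
apply: (@le_trans _ _
    (\int[K x]_y (1 + (enorm ((y : 'cV[R]_d) - x) `^ p)%:E))%E).
  apply: ge0_le_integral => //.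
  - by move=> y _; rewrite lee_fin powR_ge0.
  - exact: emeasurable_funD.
  - move=> y _; rewrite lee_fin; set q := enorm _.
    have q0 : 0 <= q by exact: enorm_ge0.
    have p'0 : 0 <= Num.min p 3 by rewrite le_min; lra.
    have [q1|/ltW q1] := leP q 1.
      rewrite (@le_trans _ _ 1) ?lerDl ?powR_ge0//.
      have := @ge0_ler_powR R _ p'0 q 1.
      by rewrite powR1 !nnegrE q0 ler01; exact.
    rewrite (@le_trans _ _ (q `^ p)) ?lerDr//.
    by apply: ler_powR => //; rewrite ge_min lexx.
rewrite ge0_integralD//; last by move=> y _; rewrite lee_fin powR_ge0.
rewrite integral_cst// prob_kernel mule1 EFinD leeD2l//.
by rewrite fineK.
Qed.

End state_space.

(** * Global properties of the two Lyapunov functions *)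

Section lyapunov_functions.
Context {R : realType} {d : nat} (a : R).
Hypothesis a0 : 0 < a.

(** As s^(-a) <= 1, the added 1 compensates the correction; nonnegativity and growth at infinity are
    then those of ln s. *)
Lemma ln_le_log_lyapunov (y : borel_cV R d) :
  ln (jsq (y : 'cV[R]_d)) <= log_lyapunov a y.
Proof.
by rewrite /log_lyapunov -addrA lerDl subr_ge0 powRN_le1 ?jsq_ge1 ?(ltW a0).
Qed.

Lemma log_lyapunov_ge0 (y : borel_cV R d) : 0 <= log_lyapunov a y.
Proof. by apply: le_trans (ln_le_log_lyapunov y); rewrite ln_ge0 ?jsq_ge1. Qed.

Lemma measurable_log_lyapunov : measurable_fun setT (@log_lyapunov R d a).
Proof.
apply: measurable_funB; last first.
  exact: measurableT_comp (measurable_powR _) measurable_jsq.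
apply: measurable_funD => //.
exact: measurableT_comp (@measurable_ln R) measurable_jsq.
Qed.

Lemma log_lyapunov_bounded (r : R) : exists b : R,
  forall y : borel_cV R d, enorm (y : 'cV[R]_d) <= r -> log_lyapunov a y <= b.
Proof.
exists (ln (1 + r ^+ 2) + 1) => y yr.
rewrite /log_lyapunov -addrA lerD//; last by rewrite gerDl oppr_le0 powR_ge0.
rewrite ler_ln ?posrE ?jsq_gt0 ?ltr_pwDl ?sqr_ge0// lerD2l.
by rewrite lerXn2r ?nnegrE ?enorm_ge0// (le_trans (enorm_ge0 y)).
Qed.

Lemma log_lyapunov_proper (M : R) : exists L : R,
  forall y : borel_cV R d, L <= enorm (y : 'cV[R]_d) -> M <= log_lyapunov a y.
Proof.
exists (expR M) => y My; apply: le_trans (ln_le_log_lyapunov y).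
rewrite -[M]expRK ler_ln ?posrE ?expR_gt0 ?jsq_gt0//.
by apply: (le_trans My); exact: enorm_le_jsq.
Qed.

Lemma log_lyapunov_recurrent (disp : measure_display)
    (Omega : measurableType disp) (P : probability Omega R)
    (S : set 'cV[R]_d) (K : R.-pker (borel_cV R d) ~> (borel_cV R d))
    (x0 : 'cV[R]_d) (X : nat -> Omega -> borel_cV R d) (r0 : R) :
  markov_process P S K x0 X -> (forall m r, P (confined X m r) = 0%E) ->
  (forall x, S x -> r0 < enorm x ->
    (\int[K x]_y (log_lyapunov a y)%:E <= (log_lyapunov a x)%:E)%E) ->
  recurrent P X.
Proof.
move=> hX nc super.
apply: (lyapunov_recurrent hX nc _ _ _ _ super).
- exact: measurable_log_lyapunov.
- exact: log_lyapunov_ge0.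
- exact: log_lyapunov_bounded.
- exact: log_lyapunov_proper.
Qed.

Lemma powR_lyapunov_transient (disp : measure_display)
    (Omega : measurableType disp) (P : probability Omega R)
    (S : set 'cV[R]_d) (K : R.-pker (borel_cV R d) ~> (borel_cV R d))
    (x0 : 'cV[R]_d) (X : nat -> Omega -> borel_cV R d) (r0 : R) :
  markov_process P S K x0 X -> (forall m r, P (confined X m r) = 0%E) ->
  (forall x, S x -> r0 < enorm x ->
    (\int[K x]_y (jsq (y : 'cV[R]_d) `^ (- a))%:E <= (jsq x `^ (- a))%:E)%E) ->
  transient P X.
Proof.
move=> hX nc super.
apply: (lyapunov_transient hX nc _ _ _ _ super).
- exact: measurableT_comp (measurable_powR _) measurable_jsq.
- by move=> y; exact: powR_ge0.
- move=> r; have r1 : 0 < 1 + r ^+ 2 by rewrite ltr_pwDl ?sqr_ge0.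
  exists ((1 + r ^+ 2) `^ (- a)) => [|y yr]; first exact: powR_gt0.
  rewrite !powRN lef_pV2 ?posrE ?powR_gt0 ?jsq_gt0//.
  rewrite ge0_ler_powR ?nnegrE ?(ltW a0) ?(ltW (jsq_gt0 _)) ?(ltW r1)//.
  by rewrite lerD2l lerXn2r ?nnegrE ?enorm_ge0// (le_trans (enorm_ge0 y)).
- move=> e e0; have [s0 _ hs0] := powR_neg_small ler01 a0 e0.
  exists s0 => y s0y; rewrite -[leLHS]mul1r; apply: hs0.
  by apply: (le_trans s0y); exact: enorm_le_jsq.
Qed.

End lyapunov_functions.

(** * From the uniform covariance error to pointwise bounds *)

Section covariance_error.
Context {R : realType} {d : nat}.
Context (S : set 'cV[R]_d) (K : R.-pker (borel_cV R d) ~> (borel_cV R d)).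
Context (sigma2 : 'cV[R]_d -> 'M[R]_d).

Lemma cov_dev_le (r : R) x : S x -> r <= enorm x ->
  ((cov_dev K sigma2 x)%:E <= cov_error K S sigma2 r)%E.
Proof. by move=> Sx rx; apply: ereal_sup_ubound; exists x. Qed.

(** Eventual finiteness has to accompany the bound on [fine], which would also be 0 if the supremum
    were infinite. *)
Lemma cov_dev_cvg0 : cov_error K S sigma2 r @[r --> +oo] --> 0%E ->
  forall e : R, 0 < e ->
  exists r, forall x, S x -> r < enorm x -> cov_dev K sigma2 x <= e.
Proof.
move=> /fine_cvgP[fin_err /cvgr0Pnorm_lt cvg_err] e e0.
have [r [_ hr]] : \forall r \near +oo,
    (cov_error K S sigma2 r \is a fin_num) /\
    `|fine (cov_error K S sigma2 r)| < e.
  by near=> r; split; near: r => //; exact: cvg_err.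
exists r => x Sx rx; have [fx lx] := hr _ rx.
rewrite -lee_fin (le_trans (cov_dev_le Sx (lexx _)))//.
by rewrite -(fineK fx) lee_fin (le_trans (ler_norm _))// ltW.
Unshelve. all: by end_near. Qed.

Lemma cov_dev_decay (h C : R) :
  (\forall r \near +oo, (cov_error K S sigma2 r <= (C * r `^ (- h))%:E)%E) ->
  exists r, forall x, S x -> r < enorm x ->
    cov_dev K sigma2 x <= C * enorm x `^ (- h).
Proof.
(* The supremum is taken over radii at least |x| itself, so the decay is read off at the radius of
   the point. *)
move=> [r [_ hr]]; exists r => x Sx rx.
by rewrite -lee_fin (le_trans (cov_dev_le Sx (lexx _)))// hr.
Qed.

End covariance_error.

Theorem theorem2p3 (R : realType) (d : nat) (hd : (1 <= d)%N)
    (disp : measure_display) (Omega : measurableType disp)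
    (P : probability Omega R)
    (S : set 'cV[R]_d)
    (S_neq0 : S !=set0)
    (S_unbounded : unbounded S)
    (S_borel : measurable (S : set (borel_cV R d)))
    (K : R.-pker (borel_cV R d) ~> (borel_cV R d))
    (x0 : 'cV[R]_d) (S_x0 : S x0)
    (X : nat -> Omega -> borel_cV R d)
    (X_markov : markov_process P S K x0 X)
    (moments : exists2 p : R, 2 < p &
      (ereal_sup [set E_incr K x (fun D => (enorm D `^ p)%R) | x in S] < +oo)%E)
    (zero_drift : forall x, S x -> drift K x = 0)
    (nondegenerate : exists2 v : R, 0 < v &
      forall x, S x -> (v%:E <= E_incr K x (fun D => (enorm D ^+ 2)%R))%E)
    (sigma2 : 'cV[R]_d -> 'M[R]_d)
    (sigma2_posdef : forall u, sphere u -> posdef (sigma2 u))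
    (sigma2_cvg : cov_error K S sigma2 r @[r --> +oo] --> 0%E)
    (U V : R) (U_gt0 : 0 < U) (U_lt_V : U < V)
    (sigma2_radial : forall u, sphere u -> (u^T *m sigma2 u *m u) 0 0 = U)
    (sigma2_trace : forall u, sphere u -> \tr (sigma2 u) = V) :
  [/\ 2 * U < V -> transient P X,
      V < 2 * U -> recurrent P X
    & 2 * U = V ->
      (exists2 delta0 : R, 0 < delta0 &
        exists C : R, \forall r \near +oo,
          (cov_error K S sigma2 r <= (C * r `^ (- delta0))%:E)%E) ->
      recurrent P X].
Proof.
have [p p2 pB] := moments.
(* From here on the exponent [q], which is at most 3, replaces [p]. *)
have [q [B [q23 moment]]] := moment_le3 p2 pB.
have [v v0 nd] := nondegenerate.
have nc := confined_null X_markov q23 moment zero_drift v0 nd.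
have dev0 := cov_dev_cvg0 sigma2_cvg.
split.
- move=> UV.
  have [a a0 [r0 super]] := powR_supermartingale q23 moment zero_drift
    U_gt0 sigma2_radial sigma2_trace UV dev0.
  exact: powR_lyapunov_transient a0 _ _ _ _ _ _ _ _ X_markov nc super.
- move=> VU.
  have [r0 super] := log_supermartingale_noncritical q23 moment zero_drift
    U_gt0 sigma2_radial sigma2_trace VU dev0.
  exact: log_lyapunov_recurrent ltr01 _ _ _ _ _ _ _ _ X_markov nc super.
- move=> UV [h h0 [C /cov_dev_decay[r hr]]].
  have [a a0 [r0 super]] := log_supermartingale_critical q23 moment zero_drift
    U_gt0 sigma2_radial sigma2_trace UV
    (ex_intro2 _ _ h h0 (ex_intro _ C (ex_intro _ r hr))).
  exact: log_lyapunov_recurrent a0 _ _ _ _ _ _ _ _ X_markov nc super.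
Qed.
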